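(* Let $U\ge1$ be an integer, $\rho>1$, $w_i=\rho^i$ for $i\ge0$, and $0<p<1/2$. Then for almost every environment $x=(x_n^u)_{n\ge1,1\le u\le U}\in\{-1,+1\}^{\mathbb{N}\times\{1,\dots,U\}}$, with respect to the law under which the $x_n^u$ are i.i.d. with $\mathbb{P}[x_n^u=1]=1-\mathbb{P}[x_n^u=-1]=p$, the Interacting Urn Mechanism $R$ in the environment $x$ satisfies $$P^x\left[R \text{ is } x\text{-suitable and satisfies } (1-p)N_{\not c}<\tfrac{U}{2}\right]=1,$$ where $N_{\not c}$ is the number of nonconformist urns of $R$.
   Context: Write $\mathcal{U}=\{1,\dots,U\}$ for the set of urns; the two colors are black and white. An Urn Path is a sequence $r=(r_n)_{n\ge0}$ in $\mathbb{Z}^{U}$ with $r_0=0$ and $r_n(u)-r_{n-1}(u)\in\{0,1\}$ for all $n\ge1$, $u\in\mathcal{U}$; $r_n(u)$ is the number of black balls in urn $u$ at time $n$, and $n-r_n(u)$ the number of white balls. The color $\mathfrak{c}_n^u$ of the ball added to urn $u$ at time $n\ge 1$ is black if $r_n(u)-r_{n-1}(u)=1$ and white if it is $0$. Interacting Urn Mechanism in the environment $x$. Put $\pi(i,j)=\frac{w_i}{w_i+w_j}=\frac{1}{1+\rho^{j-i}}$. Let $(V_n^u)_{n\ge1,u\in\mathcal{U}}$ be i.i.d. uniform on $[0,1]$. The random Urn Path $R$ is defined by $R_0=0$ and, with $B_n^u=R_n(u)$, $W_n^u=n-R_n(u)$, $B_n^*=\sum_uB_n^u$, $W_n^*=\sum_uW_n^u$: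 if $x_n^u=1$, then $R_n(u)-R_{n-1}(u)=1$ if $V_n^u<\pi(B_{n-1}^*,W_{n-1}^* )$ and $0$ otherwise; if $x_n^u=-1$, then $R_n(u)-R_{n-1}(u)=1$ if $V_n^u<\pi(B_{n-1}^u,W_{n-1}^u)$ and $0$ otherwise. $P^x$ denotes the law of $R$ for the fixed environment $x$. $x$-suitable. An Urn Path is $x$-suitable if there exist a color $\mathfrak{d}$ and a finite time $n_0$ such that each $u\in\mathcal{U}$ satisfies one of: (i) for all $n\ge n_0$, $\mathfrak{c}_n^u=\mathfrak{d}$ (then $u$ is called conformist); (ii) for all $n\ge n_0$, $\mathfrak{c}_n^u=\mathfrak{d}$ whenever $x_n^u=1$ and $\mathfrak{c}_n^u\ne\mathfrak{d}$ whenever $x_n^u=-1$ (then $u$ is called nonconformist). $N_{\not c}$ is the number of nonconformist urns. (For almost every $x$, each urn $u$ has $x_n^u=1$ infinitely often and $x_n^u=-1$ infinitely often, so $\mathfrak{d}$ and the classification are uniquely determined.) *)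

(* Defs.v *)
From mathcomp Require Import all_boot all_order all_algebra.
From mathcomp Require Import all_classical all_reals all_analysis.

Set Implicit Arguments.
Unset Strict Implicit.
Unset Printing Implicit Defensive.

Import Order.TTheory GRing.Theory Num.Theory.
Import numFieldNormedType.Exports.

Local Open Scope classical_set_scope.
Local Open Scope ring_scope.

(* Mutual independence: the product rule over every finite subfamily. *)
Definition mutually_independent (R : realType) (d d' : measure_display)
    (T : measurableType d) (T' : measurableType d') (P : probability T R)
    (I : eqType) (X : I -> T -> T') : Prop :=
  forall (J : seq I) (A : I -> set T'),
    uniq J -> (forall i, i \in J -> measurable (A i)) ->
    P (\bigcap_(i in [set` J]) (X i @^-1` A i))
      = (\prod_(i <- J) P (X i @^-1` A i))%E.

Definition iid (R : realType) (d d' : measure_display)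
    (T : measurableType d) (T' : measurableType d') (P : probability T R)
    (I : eqType) (Q : probability T' R) (X : I -> T -> T') : Prop :=
  [/\ forall i, measurable_fun setT (X i),
      forall i A, measurable A -> P (X i @^-1` A) = Q A
    & mutually_independent P X].

(* Time convention: sequences indexed by n >= 1 are shifted by one, so that
   for an environment x (and for the uniform variables and the colors below)
   the entry at index n is the one used in the step from time n to time n + 1.
   The spin is +1 when x n u = true and -1 when x n u = false. *)
Definition coordinate_events (U : nat) : set (set (nat -> 'I_U -> bool)) :=
  [set A | exists (n : nat) (u : 'I_U) (b : bool), A = [set x | x n u = b]].

(* {-1, +1}^(N x U) with its product sigma-algebra *)
Definition environment (U : nat) : measurableType (@coordinate_events U).-sigma :=
  g_sigma_algebraType (@coordinate_events U).

Definition env_coord (U : nat) (i : nat * 'I_U) (x : environment U) : bool :=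
  x i.1 i.2.

(* Number of black balls at each time in each urn. The counts start at 0 and
   have increments in {0, 1}, so nat loses nothing compared with int, and the
   number n - r n u of white balls is never truncated. *)
Definition is_urn_path (U : nat) (r : nat -> 'I_U -> nat) : Prop :=
  (forall u, r 0%N u = 0%N) /\
  (forall n u, r n.+1 u = r n u \/ r n.+1 u = (r n u).+1).

(* Colors: true is black, false is white. *)
Definition color (U : nat) (r : nat -> 'I_U -> nat) (n : nat) (u : 'I_U) : bool :=
  r n.+1 u == (r n u).+1.

Definition conformist_from (U : nat) (r : nat -> 'I_U -> nat)
    (dd : bool) (n0 : nat) (u : 'I_U) : Prop :=
  forall n, (n0 <= n)%N -> color r n u = dd.

Definition nonconformist_from (U : nat) (x : environment U)
    (r : nat -> 'I_U -> nat) (dd : bool) (n0 : nat) (u : 'I_U) : Prop :=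
  forall n, (n0 <= n)%N ->
    (x n u = true -> color r n u = dd) /\
    (x n u = false -> color r n u <> dd).

Definition suitable_from (U : nat) (x : environment U)
    (r : nat -> 'I_U -> nat) (dd : bool) (n0 : nat) : Prop :=
  forall u, conformist_from r dd n0 u \/ nonconformist_from x r dd n0 u.

Definition suitable (U : nat) (x : environment U) (r : nat -> 'I_U -> nat) : Prop :=
  is_urn_path r /\ exists (dd : bool) (n0 : nat), suitable_from x r dd n0.

(* The color dd is not an argument: for almost every x it is determined by r,
   as is the alternative satisfied by each urn. *)
Definition nonconformist (U : nat) (x : environment U)
    (r : nat -> 'I_U -> nat) (u : 'I_U) : Prop :=
  exists (dd : bool) (n0 : nat),
    suitable_from x r dd n0 /\ nonconformist_from x r dd n0 u.

Definition num_nonconformist (U : nat) (x : environment U)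
    (r : nat -> 'I_U -> nat) : nat :=
  #|[pred u : 'I_U | `[< nonconformist x r u >]]|.

Definition weight (R : realType) (rho : R) (i : nat) : R := rho ^+ i.

Definition black_prob (R : realType) (rho : R) (i j : nat) : R :=
  weight rho i / (weight rho i + weight rho j).

Fixpoint urn_mechanism (R : realType) (U : nat) (rho : R) (x : environment U)
    (v : nat * 'I_U -> R) (n : nat) : 'I_U -> nat :=
  if n is m.+1 then
    let B := urn_mechanism rho x v m in
    let W := fun u => (m - B u)%N in
    fun u =>
      if v (m, u) < (if x m u
                     then black_prob rho (\sum_(j < U) B j)%N (\sum_(j < U) W j)%N
                     else black_prob rho (B u) (W u))
      then (B u).+1 else B u
  else fun=> 0%N.

(* Main.v *)
Require Import Defs.
From mathcomp Require Import all_boot all_order all_algebra.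
From mathcomp Require Import all_classical all_reals all_analysis.
From mathcomp Require Import zify ring lra.

Set Implicit Arguments.
Unset Strict Implicit.
Unset Printing Implicit Defensive.

Import Order.TTheory GRing.Theory Num.Theory.
Import numFieldNormedType.Exports.

Local Open Scope classical_set_scope.
Local Open Scope ring_scope.

(* Averaging over the environment, the spins and colors form a process with
   explicit transition probabilities given the history, so that by Fubini it is
   enough to argue almost surely for the product of the two laws.

   Since [p < 1 / 2], the imbalance of an urn drifts away from 0 whatever the
   other urns do, and an exponential supermartingale shows that from any history
   all own-spin moves agree forever, with a probability bounded below, with the
   current signs of the imbalances; hence they eventually do. If [N] urns have
   a sign opposed to that of the total imbalance, the latter, when large, has
   drift [U - 2 (1 - p) N] in the direction of its sign. If this is positive, the
   majority moves also have a probability bounded below of agreeing forever with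
   that sign. If not, the total imbalance a.s. changes sign, after which the
   opposed urns form a minority and the drift is positive. So positive drift
   recurs, and eventually all moves follow the signs; the urns opposed to the
   total imbalance are the nonconformist ones. *)

(** * Processes with explicit transition probabilities *)

Section HistoryKernel.

Variables (R : realType) (A : finType) (K : seq A -> A -> R).
Hypothesis K_ge0 : forall h a, 0 <= K h a.
Hypothesis K_sum1 : forall h, \sum_a K h a = 1.

(** The expectation, from history [h], of [phi] after [n] more steps on the event that these are all
    [ok]. As a backward recursion it can be bounded by induction on [n], without any measure. *)
Fixpoint run (ok : seq A -> A -> bool) (phi : seq A -> R) (n : nat)
    (h : seq A) : R :=
  if n is m.+1 then \sum_a K h a * ((ok h a)%:R * run ok phi m (rcons h a))
  else phi h.

(* The probability, after history [h], that the next [n] steps are all [ok]. *)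
Definition surv ok n h := run ok (fun=> 1) n h.

Lemma run_ge0 ok phi n h : (forall h, 0 <= phi h) -> 0 <= run ok phi n h.
Proof.
by move=> phi0; elim: n h => //= n IHn h; apply: sumr_ge0 => a _; rewrite !mulr_ge0.
Qed.

Lemma surv_ge0 ok n h : 0 <= surv ok n h.
Proof. by apply: run_ge0. Qed.

Lemma surv_le1 ok n h : surv ok n h <= 1.
Proof.
elim: n h => //= n IHn h; rewrite -[leRHS](K_sum1 h); apply: ler_sum => a _.
rewrite ler_piMr//; case: (ok h a); rewrite ?mul0r// mul1r; exact: IHn.
Qed.

Lemma survS ok n h :
  surv ok n.+1 h = \sum_a K h a * ((ok h a)%:R * surv ok n (rcons h a)).
Proof. by []. Qed.

(** [Inv i] reads: [i] forced moves separate the history from one where survival is at least [e].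
    Each forced move costs a factor [delta]. *)
Lemma surv_forced (ok : seq A -> A -> bool) (a : seq A -> A)
    (delta e : R) (Inv : nat -> seq A -> Prop) :
  0 <= delta <= 1 -> 0 <= e <= 1 ->
  (forall i h, Inv i.+1 h ->
     [/\ delta <= K h (a h), ok h (a h) & Inv i (rcons h (a h))]) ->
  (forall n h, Inv 0%N h -> e <= surv ok n h) ->
  forall i n h, Inv i h -> delta ^+ i * e <= surv ok n h.
Proof.
move=> /andP[d0 d1] /andP[e0 e1] step base; elim=> [|i IHi] n h hi.
  by rewrite expr0 mul1r; exact: base.
(* If the horizon ends before the forced moves do, survival is 1. *)
case: n => [|n]; first by rewrite /surv /= mulr_ile1 ?exprn_ge0// exprn_ile1.
have [dK okh hi'] := step _ _ hi; have le_n := IHi n _ hi'.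
rewrite survS (bigD1 (a h))//= okh mul1r exprS -mulrA.
rewrite ler_wpDr// ?ler_pM// ?mulr_ge0 ?exprn_ge0//.
by apply: sumr_ge0 => b _; rewrite !mulr_ge0// surv_ge0.
Qed.

(** * Counting failed attempts *)

Section Attempts.
Variables (ok : seq A -> A -> bool) (good : pred (seq A)).

(* An attempt starts at a good history and ends at the first step that is not
   [ok]: the machine records whether an attempt is under way before the next
   step, and how many attempts have ended. *)
Fixpoint machine_rev (r : seq A) : bool * nat :=
  if r is a :: r' then
    let s := machine_rev r' in
    let h := rev r' in
    ((s.1 && ok h a) || good (rcons h a), s.2 + (s.1 && ~~ ok h a))%N
  else (good [::], 0%N).

Definition attempting h := (machine_rev (rev h)).1.
Definition failures h := (machine_rev (rev h)).2.

Lemma attempting_rcons h a :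
  attempting (rcons h a) = (attempting h && ok h a) || good (rcons h a).
Proof.
by rewrite /attempting rev_rcons /= revK.
Qed.

Lemma failures_rcons h a :
  failures (rcons h a) = (failures h + (attempting h && ~~ ok h a))%N.
Proof.
by rewrite /attempting /failures rev_rcons /= revK.
Qed.

Lemma attempting_good h : good h -> attempting h.
Proof.
by case/lastP: h => [|h a]; [|rewrite attempting_rcons => ->; rewrite orbT].
Qed.

Variable e : R.
Hypothesis e01 : 0 <= e <= 1.
Hypothesis good_surv : forall n h, good h -> e <= surv ok n h.

Definition many_failures j h : R := (j <= failures h)%N%:R.

(* Once an attempt is under way, another failure must first end it. *)
Lemma run_failures_le n j h :
  run (fun _ _ => true) (many_failures (failures h + j)) n h <=
  if attempting h then (1 - e) ^+ j.-1 * (if j is 0%N then 1 else 1 - surv ok n h)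
  else (1 - e) ^+ j.
Proof.
have /andP[e0 e1] := e01.
have e'0 : 0 <= 1 - e by rewrite subr_ge0.
have e'1 : 1 - e <= 1 by rewrite gerBl.
have run_le1 m k g : run (fun _ _ => true) (many_failures k) m g <= 1.
  elim: m g => [|m IHm] g /=; first by rewrite /many_failures; case: leqP.
  rewrite -[leRHS](K_sum1 g); apply: ler_sum => a _.
  by rewrite mul1r ler_piMr.
case: j => [|j]; first by rewrite expr0 mul1r if_same.
elim: n j h => [|n IHn] j h /=.
  rewrite /many_failures addnS ltnNge leq_addr /=.
  by rewrite /surv /= subrr mulr0; case: ifP => // _; rewrite exprn_ge0.
(* When no attempt is under way, or one is just starting at a good history, every further failure
   costs a full factor [1 - e]. *)
have bound k g : attempting g ==> good g ->
    run (fun _ _ => true) (many_failures (failures g + k)) n g <= (1 - e) ^+ k.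
  move=> gg; case: k => [|k]; first by rewrite expr0.
  apply: le_trans (IHn k g) _; case: ifPn => // att.
  rewrite /= exprSr ler_wpM2l ?exprn_ge0// lerB// good_surv//.
  by rewrite att in gg.
have -> : \sum_a K h a * (1 * run (fun _ _ => true)
    (many_failures (failures h + j.+1)) n (rcons h a)) = \sum_a K h a *
    run (fun _ _ => true) (many_failures (failures h + j.+1)) n (rcons h a).
  by apply: eq_bigr => a _; rewrite mul1r.
case: ifPn => att; last first.
  rewrite -[leRHS]mul1r -[X in _ <= X * _](K_sum1 h) mulr_suml; apply: ler_sum => a _.
  rewrite ler_wpM2l//; have := failures_rcons h a; rewrite (negbTE att)/= addn0 => <-.
  by apply: bound; rewrite attempting_rcons (negbTE att); exact/implyP.
have -> : 1 - surv ok n.+1 h =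
    \sum_a K h a * (1 - (ok h a)%:R * surv ok n (rcons h a)).
  rewrite survS -[X in X - _](K_sum1 h) -sumrB; apply: eq_bigr => a _.
  by rewrite mulrBr mulr1.
rewrite mulr_sumr; apply: ler_sum => a _.
rewrite mulrCA ler_wpM2l//.
have := failures_rcons h a; rewrite att /=; case: (boolP (ok h a)) => oka /=.
  rewrite addn0 mul1r => <-; apply: le_trans (IHn j _) _.
  by rewrite attempting_rcons att oka.
rewrite addn1 mul0r subr0 mulr1 -addSnnS => <-.
by apply: bound; rewrite attempting_rcons (negbTE oka) andbF; exact/implyP.
Qed.

End Attempts.

(** * Almost sure consequences for a process with this kernel *)

Section Law.
Context d (T : measurableType d) (Q : probability T R) (xi : nat -> T -> A).

Definition hist n w := mkseq (fun i => xi i w) n.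

Lemma histS n w : hist n.+1 w = rcons (hist n w) (xi n w).
Proof. by rewrite /hist mkseqS. Qed.

Lemma size_hist n w : size (hist n w) = n.
Proof. exact: size_mkseq. Qed.

Definition cyl h := [set w | hist (size h) w = h].

Hypothesis mxi : forall i a, measurable [set w | xi i w = a].
Hypothesis cyl_rcons : forall h a, Q (cyl (rcons h a)) = (Q (cyl h) * (K h a)%:E)%E.

(** Histories and steps range over countable types, so any condition on them is measurable. *)
Lemma measurable_hist_pred n (psi : set (seq A * A)) :
  measurable [set w | psi (hist n w, xi n w)].
Proof.
have mcyl m h : measurable [set w | hist m w = h].
  elim: m h => [|m IHm] h.
    by case: h => [|b h]; [rewrite (_ : mkset _ = setT)//|rewrite (_ : mkset _ = set0)//];
      apply/seteqP; split.
  case/lastP: h => [|h a].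
    by rewrite (_ : mkset _ = set0)//; apply/seteqP; split.
  rewrite (_ : mkset _ = [set w | hist m w = h] `&` [set w | xi m w = a]).
    exact: (measurableI _ _ (IHm h) (mxi m a)).
  apply/seteqP; split => w /=; rewrite histS; last by case=> -> ->.
  by move/rcons_inj => [-> ->].
rewrite (_ : mkset _ = \bigcup_(p : seq A * A) if `[< psi p >] then
   [set w | hist n w = p.1] `&` [set w | xi n w = p.2] else set0).
  apply: countable_bigcupT_measurable; first exact: countableP.
  by move=> p; case: ifP => // _; exact: measurableI.
apply/seteqP; split => w /=.
  by move=> pw; exists (hist n w, xi n w) => //; case: asboolP.
by case=> -[h a] _; case: asboolP => //= pw [-> ->].
Qed.

Definition stays (ok : seq A -> A -> bool) m n w :=
  all (fun i => ok (hist i w) (xi i w)) (iota m n).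

Lemma measurable_stays ok m n : measurable [set w | stays ok m n w].
Proof.
elim: n m => [|n IHn] m; first by rewrite (_ : mkset _ = setT)//; apply/seteqP; split.
rewrite (_ : mkset _ = [set w | ok (hist m w) (xi m w)] `&` [set w | stays ok m.+1 n w]).
  apply: measurableI => //.
  exact: (measurable_hist_pred m [set p | ok p.1 p.2]).
by apply/seteqP; split => w /= => [/andP[]//|[? ?]]; apply/andP.
Qed.

Lemma prob_split (X : set T) n : measurable X ->
  Q X = (\sum_a Q (X `&` [set w | xi n w = a]))%E.
Proof.
move=> mX; rewrite fsbig_seq ?index_enum_uniq// -measure_fin_bigcup//=.
- congr (Q _); apply/seteqP; split => w /=; last by case=> a _ [].
  by move=> Xw; exists (xi n w); rewrite //= mem_index_enum.
- apply/trivIsetP => a b _ _ ab; apply/seteqP; split => // w /= [[_ wa] [_ wb]].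
  by move: ab; rewrite -wa -wb eqxx.
- by move=> a _; exact: measurableI.
Qed.

(** Identifies [run] with a conditional probability: splitting on the next step, [cyl_rcons]
    produces one factor of the recursion. *)
Lemma prob_run ok (phi : pred (seq A)) n h :
  Q (cyl h `&` [set w | stays ok (size h) n w /\ phi (hist (size h + n) w)]) =
  (Q (cyl h) * (run ok (fun g => (phi g)%:R) n h)%:E)%E.
Proof.
have mcyl g : measurable (cyl g).
  exact: (measurable_hist_pred (size g) [set p | p.1 = g]).
elim: n h => [|n IHn] h.
  rewrite /= addn0; case: (boolP (phi h)) => ph /=.
    rewrite mule1; congr (Q _); apply/seteqP; split => w /= [] //.
    by move=> hw; rewrite hw.
  rewrite mule0 (_ : _ `&` _ = set0) ?measure0//; apply/seteqP; split => // w /= [hw].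
  by rewrite hw (negbTE ph) => -[].
have mX : measurable (cyl h `&` [set w | stays ok (size h) n.+1 w /\
    phi (hist (size h + n.+1) w)]).
  apply: measurableI => //; apply: measurableI; first exact: measurable_stays.
  exact: (measurable_hist_pred _ [set p | phi p.1]).
rewrite (prob_split (size h) mX) /= -sumEFin fin_num_sume_distrr//; last first.
  exact: fin_num_measure.
apply: eq_bigr => a _; rewrite EFinM muleA -cyl_rcons.
case: (boolP (ok h a)) => oka; last first.
  rewrite mul0r mule0 (_ : _ `&` _ = set0) ?measure0//; apply/seteqP; split => // w /=.
  by move=> [[hw [/andP[+ _] _]] wa]; rewrite hw wa (negbTE oka).
rewrite mul1r -IHn size_rcons addSnnS; congr (Q _); apply/seteqP; split => w /=.
  move=> [[hw [/andP[_ st] ph]] wa].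
  by rewrite /cyl /= size_rcons histS hw wa; split.
rewrite /cyl /= size_rcons histS => -[/rcons_inj[hw wa] [st ph]].
by rewrite /stays /= hw wa oka.
Qed.

(** Steps that are eventually all [ok] are so from one of countably many histories [h] on, and after
    [h] this has probability at most [surv ok n h] for every [n], hence 0. *)
Lemma not_eventually_ok ok :
  (forall h e, 0 < e -> exists n, surv ok n h <= e) ->
  {ae Q, forall w, ~ exists m, forall n, (m <= n)%N -> ok (hist n w) (xi n w)}.
Proof.
move=> die.
have cyl_null h : Q (\bigcap_n (cyl h `&` [set w | stays ok (size h) n w])) = 0%E.
  have mI n : measurable (cyl h `&` [set w | stays ok (size h) n w]).
    apply: measurableI; last exact: measurable_stays.
    exact: (measurable_hist_pred (size h) [set p | p.1 = h]).
  apply/eqP; rewrite eq_le measure_ge0 andbT; apply/lee_addgt0Pr => e e0.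
  rewrite add0e; have [n hn] := die h _ e0.
  apply: (@le_trans _ _ (Q (cyl h `&` [set w | stays ok (size h) n w]))).
    rewrite le_measure ?inE//; first exact: bigcapT_measurable.
    by move=> w; apply.
  have := prob_run ok xpredT n h.
  rewrite (_ : [set w | _ /\ _] = [set w | stays ok (size h) n w]); last first.
    by apply/seteqP; split => w /= => [[]|].
  move=> ->; rewrite -[run _ _ _ _]/(surv ok n h).
  apply: (@le_trans _ _ (1 * (surv ok n h)%:E)%E); last by rewrite mul1e lee_fin.
  rewrite lee_wpmul2r ?lee_fin ?surv_ge0//; apply: probability_le1.
  exact: (measurable_hist_pred (size h) [set p | p.1 = h]).
have: Q.-negligible (\bigcup_k \bigcup_(h in [set h | unpickle k = Some h])
    \bigcap_n (cyl h `&` [set w | stays ok (size h) n w])).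
  apply: negligible_bigcup => k; case: (unpickle k) => [h|]; last first.
    rewrite (_ : [set h | _] = set0) ?bigcup_set0; first exact: negligible_set0.
    by apply/seteqP; split.
  rewrite (_ : [set h0 | _] = [set h]) ?bigcup_set1; last first.
    by apply/seteqP; split => g /= [->].
  apply/negligibleP; last exact: cyl_null.
  apply: bigcapT_measurable => n.
  apply: measurableI; last exact: measurable_stays.
  exact: (measurable_hist_pred (size h) [set p | p.1 = h]).
apply: negligibleS => w /= /contrapT[m mok].
exists (pickle (hist m w)) => //; exists (hist m w); first by rewrite /= pickleK.
move=> n _; split => /=; first by rewrite /cyl /= size_hist.
by rewrite size_hist; apply/allP => i; rewrite mem_iota => /andP[mi _]; exact: mok.
Qed.

(* Each attempt succeeds with probability at least [e], so that a.s. there are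
   finitely many failures. *)
Lemma good_io_eventually_ok ok (good : pred (seq A)) e : 0 < e <= 1 ->
  (forall n h, good h -> e <= surv ok n h) ->
  {ae Q, forall w, (forall m, exists2 n, (m <= n)%N & good (hist n w)) ->
    exists m, forall n, (m <= n)%N -> ok (hist n w) (xi n w)}.
Proof.
move=> /andP[e0 e1] le_surv.
pose F j n := [set w | (j <= failures ok good (hist n w))%N].
have mF j n : measurable (F j n).
  exact: (measurable_hist_pred n [set p | (j <= failures ok good p.1)%N]).
have QF j n : (Q (F j n) <= ((1 - e) ^+ j)%:E)%E.
  have := prob_run (fun _ _ => true) (fun g => (j <= failures ok good g)%N) n [::].
  have -> : cyl [::] = setT by apply/seteqP; split.
  rewrite probability_setT mul1e setTI (_ : [set w | _] = F j n); last first.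
    apply/seteqP; split => w /=; first by case.
    by move=> jw; split => //; apply/allP.
  move=> ->; rewrite lee_fin.
  have := run_failures_le (ok := ok) (good := good) (e := e) _ le_surv n j [::].
  rewrite (ltW e0) e1 => /(_ isT) /= H; apply: le_trans H _.
  (* If the empty history is good, an attempt starts at once, and [1 - surv] supplies the missing
     factor [1 - e]. *)
  case: ifP => // /= att; case: j => [|j] /=; first by rewrite mulr1.
  rewrite exprSr ler_wpM2l ?exprn_ge0 ?subr_ge0// lerB// le_surv//.
have QFoo j : (Q (\bigcup_n F j n) <= ((1 - e) ^+ j)%:E)%E.
  have ndF : nondecreasing_seq (F j).
    apply/nondecreasing_seqP => n; rewrite subsetEset => w /= jw.
    by apply: leq_trans jw _; rewrite histS failures_rcons leq_addr.
  have cF := nondecreasing_cvg_mu (mu := Q) (mF j) (bigcupT_measurable _ (mF j)) ndF.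
  rewrite -(cvg_lim _ cF)//; apply: lime_le.
    by apply/cvg_ex; exists (Q (\bigcup_n F j n)).
  by apply: nearW => n; exact: QF.
(* The exceptional null set: infinitely many failures. *)
exists (\bigcap_j \bigcup_n F j n); split.
- by apply: bigcapT_measurable => j; exact: bigcupT_measurable.
- apply/eqP; rewrite eq_le measure_ge0 andbT; apply/lee_addgt0Pr => r r0.
  rewrite add0e.
  have [j hj] : exists j, (1 - e) ^+ j < r.
    have : (1 - e) ^+ j @[j --> \oo] --> (0 : R).
      by apply: cvg_expr; rewrite ger0_norm ?subr_ge0// gtrBl.
    move=> /cvgrPdist_lt /(_ _ r0) [j _ /(_ j (leqnn j))] /=.
    by rewrite sub0r normrN ger0_norm ?exprn_ge0 ?subr_ge0// => ?; exists j.
  apply: (@le_trans _ _ (Q (\bigcup_n F j n))).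
    rewrite le_measure ?inE//.
    + by apply: bigcapT_measurable => i; exact: bigcupT_measurable.
    + exact: bigcupT_measurable.
    + by move=> w; apply.
  by apply: le_trans (QFoo j) _; rewrite lee_fin ltW.
- move=> w /= /not_implyP[gio nok] j _.
  have fail_io m : exists2 n, (m <= n)%N & ~~ ok (hist n w) (xi n w).
    apply: contrapT => H; apply: nok; exists m => n mn.
    by apply: contraT => nokn; exfalso; apply: H; exists n.
  elim: j => [|j [n _ IHj]]; first by exists 0%N.
  have mono a b : (a <= b)%N ->
      (failures ok good (hist a w) <= failures ok good (hist b w))%N.
    move=> /subnK <-; elim: (b - a)%N => // k IHk; apply: leq_trans IHk _.
    by rewrite addSn histS failures_rcons leq_addr.
  (* From the good time [n1] on an attempt is under way until some step is not [ok], which happens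
     by time [n2]; this is one more failure. *)
  have [n1 nn1 gn1] := gio n.
  have [n2 n12 fn2] := fail_io n1.
  have [k n1k [attk okk]] : exists2 k, (n1 <= k)%N & attempting ok good (hist k w) /\
      ~~ ok (hist k w) (xi k w).
    apply: contrapT => H.
    suff att k : attempting ok good (hist (n1 + k) w).
      by apply: H; exists n2 => //; split => //; rewrite -(subnKC n12).
    elim: k => [|k IHk]; first by rewrite addn0; exact: attempting_good.
    rewrite addnS histS attempting_rcons IHk /=.
    case: (boolP (ok _ _)) => //= nk; exfalso; apply: H.
    by exists (n1 + k)%N; rewrite ?leq_addr.
  exists k.+1 => //; rewrite /F /mkset histS failures_rcons attk okk addn1 ltnS.
  by apply: leq_trans IHj _; apply: mono; exact: leq_trans n1k.
Qed.

End Law.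
End HistoryKernel.

(** * Exponential moments of the increments *)

Section Drift.
Variables (R : realType) (U : nat) (rho p : R).
Hypotheses (U_gt0 : (0 < U)%N) (rho_gt1 : 1 < rho) (p_gt0 : 0 < p) (p_lt : p < 1 / 2).

(* The expectation of [lam ^ X], for [X] the increment, in the direction of its
   sign, of the total imbalance when that is large and [N] urns oppose it. *)
Definition step_mgf (lam : R) (N : nat) : R :=
  lam ^+ (U - N) * ((1 - p) / lam + p * lam) ^+ N.

(** Strict Jensen: the drift in the direction of the sign is nonpositive, so the mean of
    [expR (- t * X)] exceeds 1. *)
Lemma step_mgf_gt1 (t : R) (N : nat) : 0 < t -> (N <= U)%N ->
  U%:R / 2 <= (1 - p) * N%:R -> 1 < step_mgf (expR (- t)) N.
Proof.
move=> t0 NU UN.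
have N0 : (0 < N)%N.
  case: N UN {NU} => //; rewrite mulr0 => UN; exfalso.
  have : (1 : R) <= U%:R by rewrite ler1n.
  move: UN; lra.
have [p0 p12] : 0 < p /\ p < 1 / 2 by [].
have p'0 : 0 < 1 - p by lra.
pose c : R := 1 - 2 * p.
(* An opposed urn contributes a mean exponent [c * t]; the deviations from it are [2 * p * t] and
   [- 2 * (1 - p) * t], and the strict tangent bound is applied to each. *)
have fac : expR (c * t) < (1 - p) / expR (- t) + p * expR (- t).
  have e1 : 1 + 2 * p * t < expR (2 * p * t).
    by apply: expR_gt1Dx; rewrite gt_eqF// !mulr_gt0//.
  have e2 : 1 + (- (2 * (1 - p) * t)) < expR (- (2 * (1 - p) * t)).
    apply: expR_gt1Dx; rewrite oppr_eq0 gt_eqF// !mulr_gt0//.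
  have E1 : (expR (- t))^-1 = expR (c * t) * expR (2 * p * t) :> R.
    rewrite -expRN -expRD; congr expR; rewrite /c; ring.
  have E2 : expR (- t) = expR (c * t) * expR (- (2 * (1 - p) * t)).
    rewrite -expRD; congr expR; rewrite /c; ring.
rewrite E1 E2 mulrCA [X in _ + X]mulrCA -mulrDr ltr_pMr ?expR_gt0//.
  move: e1 e2; set x := expR _; set y := expR _ => e1 e2.
  have H1 : (1 - p) * (1 + 2 * p * t) < (1 - p) * x by rewrite ltr_pM2l//; lra.
  have H2 : p * (1 - 2 * (1 - p) * t) < p * y by rewrite ltr_pM2l.
  nra.
rewrite /step_mgf.
apply: (@le_lt_trans _ _ (expR (- t) ^+ (U - N) * expR (c * t) ^+ N)).
  rewrite -!expRM_natl -expRD -[leLHS]expR0 ler_expR natrB// /c.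
  nra.
rewrite ltr_pM2l ?exprn_gt0 ?expR_gt0//.
by rewrite ltrXn2r ?expR_ge0// -lt0n N0.
Qed.

(** For [lam] slightly below 1, a positive drift brings the mean of [lam ^ X] below 1. Only finitely
    many [N] occur, so one [gam] serves all of them; [rho^-1 <= lam] lets powers of [lam] dominate
    the probabilities of minority colors. *)
Lemma step_mgf_lt1 : exists lam gam : R,
  [/\ rho^-1 <= lam, 0 < lam < 1, 0 < gam <= 1,
      (1 - p) * lam + p / lam <= 1 - gam &
      forall N, (N <= U)%N -> (1 - p) * N%:R < U%:R / 2 -> step_mgf lam N <= 1 - gam].
Proof.
pose b : R := 1 - 2 * p.
pose m (N : nat) : R := U%:R - 2 * N%:R * (1 - p).
(* The least positive drift of the total imbalance, capped at 1. *)
pose m0 : R := \big[Num.min/1]_(N < U.+1 | 0 < m N) m N.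
have m0_gt0 : 0 < m0 by rewrite /m0; elim/big_ind: _ => // x y x0 y0; rewrite lt_min x0.
have m0_le N : (N <= U)%N -> (1 - p) * N%:R < U%:R / 2 -> m0 <= m N.
  rewrite -ltnS => NU mN; rewrite /m0 (bigD1 (Ordinal NU))//=; first by rewrite ge_min lexx.
  rewrite /m; lra.
have [p0 p12 r1] : [/\ 0 < p, p < 1 / 2 & 1 < rho] by [].
have b0 : 0 < b by rewrite /b; lra.
have U1 : (1 : R) <= U%:R by rewrite ler1n.
have U0 : 0 < (4 * U%:R)^-1 :> R by rewrite invr_gt0 mulr_gt0// ltr0n.
have rho0 : 0 < rho by lra.
have rV : rho^-1 < 1 by rewrite invf_lt1.
(* With [lam = 1 - eta], the four bounds respectively keep the quadratic error below half the drift
   [m0], give [rho^-1 <= lam], leave a gain of [3 / 4 * b * eta] for a single urn, and yield the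
   expansion [eta_V]. *)
pose eta : R := Num.min (Num.min (m0 / (4 * U%:R)) (1 - rho^-1)) (Num.min (b / 4) (1 / 2)).
have eta0 : 0 < eta by rewrite /eta !lt_min mulr_gt0//= subr_gt0 rV; lra.
have : eta <= eta by [].
rewrite {2}/eta !le_min => /andP[/andP[eta_m eta_rho] /andP[eta_b eta_2]].
have eta_V : (1 - eta)^-1 <= 1 + eta + 2 * eta ^+ 2.
  rewrite -[leLHS]mul1r ler_pdivrMr; last by lra.
  by rewrite !expr2; nra.
have eta_m' : 4 * U%:R * eta <= m0 by move: eta_m; rewrite ler_pdivlMr; [rewrite mulrC|lra].
pose x : R := expR (- (eta * m0 / 2)).
have x1 : x < 1 by rewrite /x expR_lt1 oppr_lt0 divr_gt0// mulr_gt0.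
have x0 : 0 < x by exact: expR_gt0.
exists (1 - eta), (Num.min (1 - x) (3 / 4 * b * eta)); split.
- lra.
- by apply/andP; split; lra.
- rewrite lt_min ge_min !subr_gt0 x1 gerBl (ltW x0) !mulr_gt0//; lra.
- apply: (@le_trans _ _ (1 - 3 / 4 * b * eta)); last first.
    by rewrite lerB// ge_min lexx orbT.
  have H : p * (1 - eta)^-1 <= p * (1 + eta + 2 * eta ^+ 2) by rewrite ler_pM2l.
  apply: (@le_trans _ _ ((1 - p) * (1 - eta) + p * (1 + eta + 2 * eta ^+ 2))).
    by rewrite lerD2l.
  move: H; rewrite /b in eta_b *; rewrite !expr2; nra.
- move=> N NU mN; apply: (@le_trans _ _ x); last first.
    by rewrite lerBrDr -lerBrDl ge_min lexx.
  have mN0 := m0_le N NU mN.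
  have f0 : 0 <= (1 - p) / (1 - eta) + p * (1 - eta).
    by rewrite addr_ge0 ?mulr_ge0 ?invr_ge0//; lra.
  have f1 : (1 - p) / (1 - eta) + p * (1 - eta) <= expR (b * eta + 2 * eta ^+ 2).
    apply: le_trans (expR_ge1Dx _); rewrite /b.
    have H : (1 - p) * (1 - eta)^-1 <= (1 - p) * (1 + eta + 2 * eta ^+ 2).
      by rewrite ler_wpM2l//; lra.
    rewrite !expr2 in H *; nra.
  have f2 : 1 - eta <= expR (- eta) by rewrite expR_ge1Dx.
  apply: (@le_trans _ _ (expR (- eta) ^+ (U - N) * expR (b * eta + 2 * eta ^+ 2) ^+ N)).
    rewrite ler_pM ?exprn_ge0//; [lra| |].
      by rewrite lerXn2r ?nnegrE ?expR_ge0//; lra.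
    by rewrite lerXn2r ?nnegrE ?expR_ge0//.
  rewrite -!expRM_natl -expRD ler_expR natrB//.
  have NU' : N%:R <= U%:R :> R by rewrite ler_nat.
  have N0 : 0 <= N%:R :> R by [].
  have h1 : eta * m0 <= eta * m N by rewrite ler_pM2l.
  have h2 : 2 * N%:R * eta ^+ 2 <= eta * m0 / 2.
    rewrite expr2; nra.
  rewrite /m /b in h1 *; nra.
Qed.

End Drift.

(** * The kernel of the urn process *)

Definition sg (b : bool) : int := if b then 1 else -1.

Lemma sg_sq b : sg b * sg b = 1. Proof. by case: b. Qed.

Lemma sg_mul_ge b c : -1 <= sg b * sg c. Proof. by case: b c => -[]. Qed.

Lemma sgN b : sg (~~ b) = - sg b. Proof. by case: b. Qed.

Lemma sg_normE (z : int) : sg (0 <= z) * z = `|z|.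
Proof. by rewrite /sg; case: (ger0P z) => _; lia. Qed.

Lemma sg_norm_ge b (z : int) : sg b * z <= `|z|.
Proof. by rewrite /sg; case: b; lia. Qed.

Lemma sg_mul_gt0 b (z : int) : 1 <= sg b * z -> (0 <= z) = b.
Proof. by case: b; rewrite /sg; lia. Qed.

Section UrnKernel.
Variables (R : realType) (U : nat) (rho p : R).
Hypotheses (U_gt0 : (0 < U)%N) (rho_gt1 : 1 < rho) (p_gt0 : 0 < p) (p_lt : p < 1 / 2).

(* One step of the process: the spin and the color of each urn. *)
Definition step := {ffun 'I_U -> bool * bool}.

Implicit Types (h : seq step) (a : step) (u : 'I_U).

Definition nblack h u := count (fun a : step => (a u).2) h.

Definition bprob h u (x : bool) : R :=
  if x then black_prob rho (\sum_(v < U) nblack h v)%N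
                           (\sum_(v < U) (size h - nblack h v))%N
  else black_prob rho (nblack h u) (size h - nblack h u).

Definition cprob h u (x c : bool) : R := if c then bprob h u x else 1 - bprob h u x.

Definition urn_kernel h u (xc : bool * bool) : R :=
  (if xc.1 then p else 1 - p) * cprob h u xc.1 xc.2.

Definition step_kernel h a : R := \prod_u urn_kernel h u (a u).

Definition imbalance h u : int := (nblack h u)%:Z - (size h - nblack h u)%N%:Z.
Definition total_imbalance h : int := \sum_u imbalance h u.
(** Ties count as black; at a tie both colors have probability 1/2, so the bounds below hold for
    either choice. *)
Definition major h u : bool := 0 <= imbalance h u.
Definition total_major h : bool := 0 <= total_imbalance h.

Lemma imbalance_rcons h a u : imbalance (rcons h a) u = imbalance h u + sg (a u).2.
Proof.
rewrite /imbalance /nblack size_rcons -cats1 count_cat /= addn0.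
move: (count _ _) (size h) (count_size (fun a : step => (a u).2) h) => m n.
by case: (a u).2 => /=; clear; lia.
Qed.

Lemma total_imbalance_rcons h a :
  total_imbalance (rcons h a) = total_imbalance h + \sum_u sg (a u).2.
Proof.
rewrite /total_imbalance -big_split /=.
by apply: eq_bigr => u _; rewrite imbalance_rcons.
Qed.

Lemma total_imbalanceE h : total_imbalance h =
  (\sum_(v < U) nblack h v)%N%:Z - (\sum_(v < U) (size h - nblack h v))%N%:Z.
Proof. by rewrite /total_imbalance sumrB -!(big_morph Posz PoszD (erefl _)). Qed.

Lemma black_prob_ge0 i j : 0 <= black_prob rho i j.
Proof.
have r0 : 0 < rho by apply: lt_trans rho_gt1.
by rewrite /black_prob /weight divr_ge0 ?addr_ge0 ?exprn_ge0// ltW.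
Qed.

Lemma black_probC i j : 1 - black_prob rho i j = black_prob rho j i.
Proof.
have r0 : 0 < rho by apply: lt_trans rho_gt1.
rewrite /black_prob /weight.
have i0 : 0 < rho ^+ i by rewrite exprn_gt0.
have j0 : 0 < rho ^+ j by rewrite exprn_gt0.
by field; rewrite ?gt_eqF// addr_gt0.
Qed.

Lemma black_prob_minor i j : (i <= j)%N -> black_prob rho i j <= rho^-1 ^+ (j - i).
Proof.
move=> ij; have r0 : 0 < rho by apply: lt_trans rho_gt1.
rewrite /black_prob /weight -[in X in _ / (_ + X)](subnK ij) exprD.
have i0 : 0 < rho ^+ i by rewrite exprn_gt0.
have d0 : 0 < rho ^+ (j - i) by rewrite exprn_gt0.
rewrite exprVn ler_pdivrMr ?addr_gt0 ?mulr_gt0//.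
by rewrite mulrDr mulrA mulVf ?gt_eqF// mul1r lerDr mulr_ge0 ?invr_ge0 ?ltW.
Qed.

Lemma black_prob_major i j : (j <= i)%N -> 1 / 2 <= black_prob rho i j.
Proof.
move=> ij; have r0 : 0 < rho by apply: lt_trans rho_gt1.
have := black_prob_minor ij.
have i0 : 0 < rho ^+ i by rewrite exprn_gt0.
have j0 : 0 < rho ^+ j by rewrite exprn_gt0.
have ji : rho ^+ j <= rho ^+ i by rewrite ler_weXn2l// ltW.
rewrite /black_prob /weight ler_pdivlMr ?addr_gt0//; lra.
Qed.

Lemma cprob_ge0 h u x c : 0 <= cprob h u x c.
Proof.
by rewrite /cprob /bprob; case: c; case: x; rewrite ?black_probC ?black_prob_ge0.
Qed.

Lemma cprobN h u x c : cprob h u x (~~ c) = 1 - cprob h u x c.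
Proof. by rewrite /cprob; case: c => //=; rewrite opprB addrC subrK. Qed.

Lemma cprob_le1 h u x c : cprob h u x c <= 1.
Proof. by rewrite -subr_ge0 -cprobN cprob_ge0. Qed.

(** Stated for arbitrary counts, to serve both a single urn and the totals. *)
Let cprob_bounds i j (z := i%:Z - j%:Z) (c := 0 <= z) (q := black_prob rho i j) :
  (if ~~ c then q else 1 - q) <= rho^-1 ^+ `|z|%N /\
  1 / 2 <= (if c then q else 1 - q).
Proof.
rewrite /q black_probC /c /z; case: (lerP 0 (i%:Z - j%:Z)) => ij /=.
  have ji : (j <= i)%N by lia.
  by rewrite black_prob_major// (_ : `|_|%N = i - j)%N ?black_prob_minor//; lia.
have ji : (i <= j)%N by lia.
by rewrite black_prob_major// (_ : `|_|%N = j - i)%N ?black_prob_minor//; lia.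
Qed.

Lemma cprob_minor h u :
  cprob h u false (~~ major h u) <= rho^-1 ^+ `|imbalance h u|%N.
Proof. by have [] := cprob_bounds (nblack h u) (size h - nblack h u). Qed.

Lemma cprob_major h u : 1 / 2 <= cprob h u false (major h u).
Proof. by have [] := cprob_bounds (nblack h u) (size h - nblack h u). Qed.

Lemma cprob_total_minor h u :
  cprob h u true (~~ total_major h) <= rho^-1 ^+ `|total_imbalance h|%N.
Proof.
rewrite /total_major total_imbalanceE.
by have [] := cprob_bounds (\sum_(v < U) nblack h v)%N
                           (\sum_(v < U) (size h - nblack h v))%N.
Qed.

Lemma cprob_total_major h u : 1 / 2 <= cprob h u true (total_major h).
Proof.
rewrite /total_major total_imbalanceE.
by have [] := cprob_bounds (\sum_(v < U) nblack h v)%N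
                           (\sum_(v < U) (size h - nblack h v))%N.
Qed.

(** The reference colors [s] and [t] will be signs of imbalances, which separates moves that follow
    a sign from moves against it. *)
Lemma sum_bool_pair (s t : bool) (F : bool * bool -> R) : \sum_xc F xc =
  F (false, s) + F (false, ~~ s) + (F (true, t) + F (true, ~~ t)).
Proof.
have sum_bool (b : bool) (G : bool -> R) : \sum_c G c = G b + G (~~ b).
  by rewrite big_bool; case: b => //=; rewrite addrC.
have -> : \sum_xc F xc = \sum_x \sum_c F (x, c).
  by rewrite pair_bigA; apply: eq_bigr => -[].
rewrite (sum_bool false) /=.
by rewrite (sum_bool s) (sum_bool t).
Qed.

Lemma urn_kernel_ge0 h u xc : 0 <= urn_kernel h u xc.
Proof.
have [p0 p12] : 0 < p /\ p < 1 / 2 by [].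
by rewrite mulr_ge0 ?cprob_ge0//; case: ifP => _; lra.
Qed.

Lemma urn_kernel_sum1 h u : \sum_xc urn_kernel h u xc = 1.
Proof. rewrite (sum_bool_pair true true) /urn_kernel /= /cprob; lra. Qed.

Lemma step_kernel_ge0 h a : 0 <= step_kernel h a.
Proof. by apply: prodr_ge0 => u _; exact: urn_kernel_ge0. Qed.

(** Given the history the urns move independently, so expectations of products factorize. *)
Lemma step_kernel_prod h (F : 'I_U -> bool * bool -> R) :
  \sum_a step_kernel h a * \prod_u F u (a u) =
  \prod_u \sum_xc urn_kernel h u xc * F u xc.
Proof.
by rewrite bigA_distr_bigA; apply: eq_bigr => a _; rewrite -big_split.
Qed.

Lemma step_kernel_sum1 h : \sum_a step_kernel h a = 1.
Proof.
rewrite /step_kernel -(bigA_distr_bigA (urn_kernel h)).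
by apply: big1 => u _; exact: urn_kernel_sum1.
Qed.

Lemma step_kernel_marginal h u (g : bool * bool -> R) :
  \sum_a step_kernel h a * g (a u) = \sum_xc urn_kernel h u xc * g xc.
Proof.
have := step_kernel_prod h (fun v xc => if v == u then g xc else 1).
rewrite [RHS](bigD1 u)//= eqxx [X in _ * X]big1 ?mulr1 => [<-|v /negPf vu].
  apply: eq_bigr => a _; rewrite (bigD1 u)//= eqxx big1 ?mulr1// => v /negPf vu.
  by rewrite vu.
by rewrite vu; under eq_bigr do rewrite mulr1; exact: urn_kernel_sum1.
Qed.

(* The own-spin moves follow the signs of the urns and no imbalance changes sign;
   with [total], the majority moves follow the sign of the total imbalance too.
   The threshold [kap] makes imbalances increase in size up to [kap] and then
   stay above it. *)
Definition okstep (kap : int) (total : bool) h a : bool :=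
  [forall u, [&& ~~ (a u).1 ==> ((a u).2 == major h u),
     Num.min kap (`|imbalance h u| + 1) <=
       sg (major h u) * imbalance (rcons h a) u
   & total && (a u).1 ==> ((a u).2 == total_major h)]]
  && (total ==> (1 <= sg (total_major h) * total_imbalance (rcons h a))).

Definition minority h := #|[pred u | major h u != total_major h]|.

(** Positivity of the drift of the total imbalance in the direction of its sign. *)
Definition supercritical h : bool := (1 - p) * (minority h)%:R < U%:R / 2.

Lemma minority_le h : (minority h <= U)%N.
Proof. by rewrite -[leqRHS]card_ord; exact: max_card. Qed.

Lemma okstep_major kap total h a : 1 <= kap -> okstep kap total h a ->
  forall u, major (rcons h a) u = major h u.
Proof.
move=> kap1 /andP[/forallP ok _] u; have /and3P[_ H _] := ok u.
by apply: sg_mul_gt0; apply: le_trans H; rewrite le_min kap1 lerDr.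
Qed.

Lemma okstep_total_major kap h a : okstep kap true h a ->
  total_major (rcons h a) = total_major h.
Proof. by move=> /andP[_ /= H]; exact: sg_mul_gt0. Qed.

Lemma eq_minority h h' : (forall u, major h' u = major h u) ->
  total_major h' = total_major h -> minority h' = minority h.
Proof. by move=> H1 H2; apply: eq_card => u; rewrite !inE H1 H2. Qed.

(** Aligned and opposed urns exchange roles. As a failure of [supercritical] forces a minority
    larger than [U / 2], it cannot hold on both sides of a flip. *)
Lemma minority_flip h h' : (forall u, major h' u = major h u) ->
  total_major h' != total_major h -> (minority h' + minority h)%N = U.
Proof.
move=> H1 H2; rewrite -[RHS]card_ord -(cardC [pred u | major h' u != total_major h']).
congr (_ + _)%N; apply: eq_card => u; rewrite !inE H1 negbK.
by move: H2; case: (total_major h'); case: (total_major h); case: (major h u).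
Qed.

(** Each factor is the mean for one urn whose own-spin moves follow its own sign and whose majority
    moves follow that of the total. *)
Lemma prod_step_mgf lam h : lam != 0 ->
  \prod_u ((1 - p) * lam ^ (sg (total_major h) * sg (major h u)) + p * lam) =
  step_mgf U p lam (minority h).
Proof.
move=> lam0.
have Nc : #|[pred u | major h u == total_major h]| = (U - minority h)%N.
  have E : (minority h + #|[pred u | major h u == total_major h]|)%N = U.
    rewrite -[RHS]card_ord -(cardC [pred u | major h u != total_major h]).
    by congr (_ + _)%N; apply: eq_card => u; rewrite !inE negbK.
  by apply/eqP; rewrite -(eqn_add2l (minority h)) subnKC ?minority_le// E.
rewrite (bigID (fun u => major h u == total_major h)) /=.
rewrite (eq_bigr (fun=> lam)) => [|u /eqP ->]; last first.
  by rewrite sg_sq expr1z; ring.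
rewrite prodr_const Nc (eq_bigr (fun=> (1 - p) / lam + p * lam)) => [|u Hu]; last first.
  have -> : total_major h = ~~ major h u.
    by case: (major h u) (total_major h) Hu => -[].
  by rewrite sgN mulNr sg_sq exprN1.
by rewrite prodr_const.
Qed.

Lemma exprz_anti (lam : R) (z w : int) : 0 < lam < 1 -> z <= w -> lam ^ w <= lam ^ z.
Proof.
move=> /andP[l0 l1] zw; rewrite -(subrK z w) expfzDr ?gt_eqF// ler_piMl ?exprz_ge0 ?(ltW l0)//.
by rewrite -(gez0_abs (m := w - z)) ?subr_ge0// -exprnP exprn_ile1// ltW.
Qed.

Lemma exprz_le1 (lam : R) (z : int) : 0 < lam < 1 -> 0 <= z -> lam ^ z <= 1.
Proof. by move=> l01 z0; rewrite -(expr0z lam) exprz_anti. Qed.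

(** * An exponential supermartingale *)

Section Potential.
Variables lam gam : R.
Hypotheses (lam_rho : rho^-1 <= lam) (lam01 : 0 < lam < 1).
Hypothesis lam_own : (1 - p) * lam + p / lam <= 1 - gam.
Hypothesis lam_total : forall N, (N <= U)%N -> (1 - p) * N%:R < U%:R / 2 ->
  step_mgf U p lam N <= 1 - gam.

Let lam0 : lam != 0. Proof. by case/andP: lam01 => /lt0r_neq0. Qed.

Let powz_ge0 (z : int) : 0 <= lam ^ z.
Proof. by rewrite exprz_ge0// ltW//; case/andP: lam01. Qed.

Let powz_anti (z w : int) : z <= w -> lam ^ w <= lam ^ z.
Proof. by move=> zw; exact: exprz_anti. Qed.

Let minor_le (z : int) : rho^-1 ^+ `|z|%N <= lam ^ `|z|.
Proof.
have r0 : 0 < rho by apply: lt_trans rho_gt1.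
rewrite -abszE -exprnP lerXn2r ?nnegrE ?invr_ge0 ?(ltW r0)// ltW//.
by case/andP: lam01.
Qed.

(** An upper bound for the probability that some later step violates [okstep]. *)
Definition potential (C : R) (total : bool) h : R :=
  C * (\sum_u lam ^ `|imbalance h u| + total%:R * lam ^ `|total_imbalance h|).

Let own_err h u (xc : bool * bool) := ~~ xc.1 && (xc.2 != major h u).
Let total_err h (xc : bool * bool) := xc.1 && (xc.2 != total_major h).

(** An own-spin error costs 1; otherwise the cost is the share of the urn in the next potential,
    with the signed imbalance in place of its absolute value. Given [h], it depends on the move of
    that urn only. *)
Let own_cost C h u (xc : bool * bool) : R := (own_err h u xc)%:R +
  C * ((~~ own_err h u xc)%:R * lam ^ (`|imbalance h u| + sg (major h u) * sg xc.2)).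

(** One factor per urn, so that the expectation of the total term factorizes; it vanishes on
    errors. *)
Let total_move h u (xc : bool * bool) : R :=
  (~~ own_err h u xc && ~~ total_err h xc)%:R * lam ^ (sg (total_major h) * sg xc.2).

(** A pathwise bound. If the costs reach 1 there is nothing to prove. Otherwise there is no error,
    and [1 <= C * lam ^ kap] forces signed imbalances of at least [kap]: the step is ok, and the
    costs dominate the next potential. *)
Lemma potential_step kap total (C : R) h a (s : R) :
  0 <= C -> 1 <= C * lam ^ kap -> 1 <= kap ->
  1 - potential C total (rcons h a) <= s <= 1 ->  0 <= s ->
  1 - (okstep kap total h a)%:R * s <=
  \sum_u own_cost C h u (a u) + total%:R *
  (\sum_u (total_err h (a u))%:R + C * (lam ^ `|total_imbalance h| *
     \prod_u total_move h u (a u))).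
Proof.
move=> C0 Ckap kap1 /andP[ps s1] s0.
set X : R := \sum_u own_cost _ _ _ _; set Y : R := \sum_u _; set Z : R := C * (_ * _).
have oc0 u : 0 <= own_cost C h u (a u) by rewrite addr_ge0 ?mulr_ge0.
have Z0 : 0 <= Z.
  by rewrite /Z !mulr_ge0//; apply: prodr_ge0 => u _; rewrite mulr_ge0.
have Y0 : 0 <= Y by apply: sumr_ge0.
have X0 : 0 <= X by apply: sumr_ge0.
have lhs1 : 1 - (okstep kap total h a)%:R * s <= 1 by rewrite gerBl mulr_ge0.
have [R1|R1] := leP 1 (X + total%:R * (Y + Z)); first exact: le_trans lhs1 R1.
have T0 : 0 <= total%:R * (Y + Z) by rewrite mulr_ge0// addr_ge0.
have X1 : X < 1 by apply: le_lt_trans R1; rewrite lerDl.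
have T1 : total%:R * (Y + Z) < 1 by apply: le_lt_trans R1; rewrite lerDr.
have oc1 u : own_cost C h u (a u) < 1.
  apply: le_lt_trans X1; rewrite /X (bigD1 u)//= lerDl.
  by apply: sumr_ge0.
have noerr u : ~~ own_err h u (a u).
  apply/negP => err; have := oc1 u.
  by rewrite /own_cost err mul0r mulr0 addr0 ltxx.
have imb u : sg (major h u) * imbalance (rcons h a) u =
    `|imbalance h u| + sg (major h u) * sg (a u).2.
  by rewrite imbalance_rcons mulrDr sg_normE.
have oc u : own_cost C h u (a u) =
    C * lam ^ (sg (major h u) * imbalance (rcons h a) u).
  by rewrite /own_cost imb (negbTE (noerr u)) add0r mul1r.
have imb_kap u : kap <= sg (major h u) * imbalance (rcons h a) u.
  rewrite leNgt; apply/negP => lt_kap; have := oc1 u; apply/negP; rewrite -leNgt oc.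
  by apply: le_trans Ckap _; rewrite ler_wpM2l// powz_anti// ltW.
have noterr : total -> forall u, ~~ total_err h (a u).
  move=> tot u; apply/negP => err; move: T1; apply/negP; rewrite -leNgt tot mul1r.
  apply: (@le_trans _ _ Y); last by rewrite lerDl.
  by rewrite /Y (bigD1 u)//= err lerDl; apply: sumr_ge0.
have ZE : total -> Z =
    C * lam ^ (sg (total_major h) * total_imbalance (rcons h a)).
  move=> tot; rewrite /Z total_imbalance_rcons mulrDr sg_normE expfzDr//.
  congr (_ * (_ * _)); rewrite mulr_sumr.
  rewrite (big_morph (exprz lam) (fun x y => expfzDr x y lam0) (expr0z lam)).
  by apply: eq_bigr => u _; rewrite /total_move noerr (noterr tot) mul1r.
have tot_pos : total -> 1 <= sg (total_major h) * total_imbalance (rcons h a).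
  move=> tot; rewrite leNgt; apply/negP => lt1.
  have C1 : 1 <= C.
    apply: le_trans Ckap _; rewrite -[leRHS]mulr1 -(expr0z lam) ler_wpM2l// powz_anti//.
    exact: le_trans kap1.
  move: T1; apply/negP; rewrite -leNgt tot mul1r.
  apply: (@le_trans _ _ Z); last by rewrite lerDr.
  rewrite (ZE tot); apply: le_trans C1 _; rewrite -[leLHS]mulr1 -(expr0z lam).
  by rewrite ler_wpM2l// powz_anti// -ltzD1.
have -> : okstep kap total h a.
  apply/andP; split; last by apply/implyP.
  apply/forallP => u; apply/and3P; split.
  - by have := noerr u; rewrite /own_err; case: (a u) => -[] c //=; rewrite negbK.
  - by apply: le_trans (imb_kap u); rewrite ge_min lexx.
  - apply/implyP => /andP[tot xu]; have := noterr tot u.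
    by rewrite /total_err xu negbK.
rewrite mul1r; apply: (@le_trans _ _ (potential C total (rcons h a))).
  by rewrite lerBlDr -lerBlDl.
rewrite /potential mulrDr lerD//.
  rewrite mulr_sumr; apply: ler_sum => u _; rewrite oc ler_wpM2l// powz_anti//.
  exact: sg_norm_ge.
case: (boolP total) => tot; last by rewrite !mul0r mulr0.
rewrite !mul1r (ZE tot) -[leLHS]add0r lerD// ler_wpM2l// powz_anti//.
exact: sg_norm_ge.
Qed.

Let nbb (b : bool) : (~~ b == b) = false. Proof. by case: b. Qed.

(** At worst all majority moves go against the sign of the urn, which still leaves a mean factor of
    at most [1 - gam]. The gain [gam], multiplied by [C], pays for the error probability. *)
Let own_cost_le (C : R) h u : 0 <= C -> 1 <= C * gam ->
  \sum_xc urn_kernel h u xc * own_cost C h u xc <= C * lam ^ `|imbalance h u|.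
Proof.
move=> C0 Cgam; have [[p0 p12] /andP[l0 l1]] := (conj (conj p_gt0 p_lt) lam01).
rewrite (sum_bool_pair (major h u) (major h u)) /urn_kernel /own_cost /own_err /=.
rewrite eqxx nbb /= sgN mulrN sg_sq !expfzDr// expr1z exprN1 !cprobN.
have := cprob_minor h u; have := minor_le (imbalance h u); rewrite cprobN.
have := powz_ge0 `|imbalance h u|.
have := cprob_ge0 h u true (major h u); have := cprob_le1 h u true (major h u).
have := cprob_ge0 h u false (major h u); have := cprob_le1 h u false (major h u).
set q := cprob h u false _; set r := cprob h u true _; set L := lam ^ _.
set rr := rho^-1 ^+ _ => q1 q0 r1 r0 L0 rrL qrr.
have own := lam_own; have lV : lam <= lam^-1.
  by apply: le_trans (ltW l1) _; rewrite invf_ge1// ltW.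
have CL0 : 0 <= C * L by exact: mulr_ge0.
have h1 : (1 - p) * q * (C * (L * lam)) <= (1 - p) * (C * (L * lam)).
  by rewrite ler_wpM2r ?mulr_ge0 ?(ltW l0)// ler_piMr//; lra.
have h2 : (1 - p) * (1 - q) <= L.
  by apply: (@le_trans _ _ (1 - q)); [rewrite ler_piMl; lra|lra].
have h3 : p * r * (C * (L * lam)) <= p * r * (C * (L * lam^-1)).
  by rewrite ler_wpM2l ?mulr_ge0 ?(ltW p0)// ler_wpM2l// ler_wpM2l.
have h4 : C * L * ((1 - p) * lam + p / lam) <= C * L * (1 - gam).
  by rewrite ler_wpM2l.
have h5 : L <= C * gam * L by rewrite ler_peMl.
rewrite !add0r !mul0r !mul1r !mulr0 !addr0 mulr1.
move: h1 h2 h3 h4 h5; set V := lam^-1; lra.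
Qed.

Let total_err_le h u :
  \sum_xc urn_kernel h u xc * (total_err h xc)%:R <= lam ^ `|total_imbalance h|.
Proof.
have [p0 p12] : 0 < p /\ p < 1 / 2 by [].
rewrite (sum_bool_pair (total_major h) (total_major h)) /urn_kernel /total_err /=.
rewrite eqxx nbb /= !mulr0 mulr1 !add0r.
apply: le_trans (minor_le _); apply: le_trans (cprob_total_minor h u).
by rewrite ler_piMl ?cprob_ge0//; lra.
Qed.

Let total_move_le h u : \sum_xc urn_kernel h u xc * total_move h u xc <=
  (1 - p) * lam ^ (sg (total_major h) * sg (major h u)) + p * lam.
Proof.
have [p0 p12] : 0 < p /\ p < 1 / 2 by [].
have /andP[l0 l1] := lam01.
rewrite (sum_bool_pair (major h u) (total_major h)) /urn_kernel /total_move.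
rewrite /total_err /own_err /= !eqxx !nbb /= sg_sq expr1z !mul0r !mulr0 !addr0 !mul1r.
rewrite lerD//.
  by rewrite ler_wpM2r// ler_piMr ?cprob_le1//; lra.
by rewrite ler_wpM2r ?(ltW l0)// ler_piMr ?cprob_le1// ltW.
Qed.

(** Here [s a] stands for survival after the step [a]. Taking the mean of the pathwise bound, own
    costs reduce to marginals and the total term to a product over urns. *)
Lemma potential_superharmonic kap (total : bool) (C : R) h (s : step -> R) :
  0 <= C -> 1 <= C * lam ^ kap -> 1 <= kap -> U%:R <= C * gam ->
  (total -> supercritical h) ->
  (forall a, okstep kap total h a ->
     [/\ 1 - potential C total (rcons h a) <= s a, 0 <= s a & s a <= 1]) ->
  1 - \sum_a step_kernel h a * ((okstep kap total h a)%:R * s a) <=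
  potential C total h.
Proof.
move=> C0 Ckap kap1 Cgam tot_sup sP.
have U1 : (1 : R) <= U%:R by rewrite ler1n.
have C1 : 1 <= C * gam by exact: le_trans Cgam.
rewrite -[X in X - _](step_kernel_sum1 h) -sumrB.
apply: (@le_trans _ _ (\sum_a step_kernel h a * (\sum_u own_cost C h u (a u) +
    total%:R * (\sum_u (total_err h (a u))%:R + C * (lam ^ `|total_imbalance h| *
     \prod_u total_move h u (a u)))))).
  apply: ler_sum => a _; rewrite -[X in X - _]mulr1 -mulrBr.
  rewrite ler_wpM2l ?step_kernel_ge0//.
  case: (boolP (okstep kap total h a)) => oka.
    have [s1 s2 s3] := sP a oka.
    have H : 1 - potential C total (rcons h a) <= s a <= 1 by rewrite s1 s3.
    by have := potential_step (h := h) C0 Ckap kap1 H s2; rewrite oka.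
  (* On a forbidden step the value of [s] does not enter; 1 is an admissible choice. *)
  have := potential_step (kap := kap) (total := total) (h := h) (a := a) (s := 1) C0 Ckap kap1.
  rewrite (negbTE oka) !mul0r; apply => //; rewrite lexx andbT gerBl.
  by rewrite /potential mulr_ge0// addr_ge0 ?mulr_ge0// sumr_ge0.
under eq_bigr do rewrite mulrDr mulr_sumr.
rewrite big_split /= exchange_big /= /potential mulrDr lerD//.
  rewrite mulr_sumr; apply: ler_sum => u _.
  by rewrite (step_kernel_marginal h u (own_cost C h u)); exact: own_cost_le.
case: total {sP} tot_sup => [/(_ isT) sup|_]; last first.
  by rewrite !mul0r mulr0 big1// => a _; rewrite mul0r mulr0.
under eq_bigr do rewrite mul1r mulrDr mulr_sumr.
rewrite big_split /= exchange_big /= mul1r.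
set L := lam ^ `|total_imbalance h|.
have L0 : 0 <= L by exact: powz_ge0.
(* The gain [C * gam] of the total term pays for the majority errors of all [U] urns. *)
apply: (@le_trans _ _ (U%:R * L + C * L * (1 - gam))); last first.
  by have := ler_wpM2r L0 Cgam; lra.
rewrite lerD//.
  rewrite -[X in X%:R](card_ord U) -sumr_const mulr_suml; apply: ler_sum => u _.
  rewrite mul1r (step_kernel_marginal h u (fun xc => (total_err h xc)%:R)).
  exact: total_err_le.
have -> : \sum_a step_kernel h a * (C * (L * \prod_u total_move h u (a u))) =
    C * L * \sum_a step_kernel h a * \prod_u total_move h u (a u).
  by rewrite mulr_sumr; apply: eq_bigr => a _; ring.
rewrite step_kernel_prod ler_wpM2l ?mulr_ge0//.
apply: (@le_trans _ _ (step_mgf U p lam (minority h))).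
  rewrite -(prod_step_mgf h lam0); apply: ler_prod => u _.
  rewrite total_move_le andbT; apply: sumr_ge0 => xc _.
  by rewrite mulr_ge0 ?urn_kernel_ge0// mulr_ge0 ?powz_ge0.
by apply: lam_total; rewrite ?minority_le.
Qed.

(** Induction on the horizon: ok steps of the [total] kind preserve all signs, hence the minority
    and supercriticality. *)
Lemma surv_potential kap (total : bool) (C : R) : 0 <= C -> 1 <= C * lam ^ kap -> 1 <= kap ->
  U%:R <= C * gam -> forall n h, (total -> supercritical h) ->
  1 - potential C total h <= surv step_kernel (okstep kap total) n h.
Proof.
move=> C0 Ckap kap1 Cgam; elim=> [|n IHn] h sup.
  rewrite /surv /= gerBl /potential mulr_ge0// addr_ge0 ?mulr_ge0//.
  by rewrite sumr_ge0.
rewrite survS lerBlDr -lerBlDl; apply: potential_superharmonic => // a oka; split.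
- apply: IHn => tot; have := sup tot; rewrite /supercritical (eq_minority (h := h))//.
    exact: okstep_major oka.
  by move: oka; rewrite tot; exact: okstep_total_major.
- by apply: surv_ge0; exact: step_kernel_ge0.
- by apply: surv_le1; [exact: step_kernel_ge0|exact: step_kernel_sum1].
Qed.

End Potential.

(** * Survival with probability bounded below *)

Lemma geometric_small (c r e : R) : 0 <= r < 1 -> 0 < e -> exists n, c * r ^+ n <= e.
Proof.
move=> /andP[r0 r1] e0.
have : c * r ^+ n @[n --> \oo] --> (c * 0 : R).
  by apply: cvgMr => //; apply: cvg_expr; rewrite ger0_norm.
rewrite mulr0 => /cvgrPdist_le /(_ _ e0) [n _ /(_ n (leqnn n))] /=.
by rewrite sub0r normrN => H; exists n; apply: le_trans H; exact: ler_norm.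
Qed.

Lemma step_kernel_ge (q : R) h a : 0 <= q -> (forall u, q <= urn_kernel h u (a u)) ->
  q ^+ U <= step_kernel h a.
Proof.
move=> q0 qle; rewrite -[X in _ ^+ X](card_ord U) -prodr_const /step_kernel.
by apply: ler_prod => u _; rewrite q0 qle.
Qed.

Lemma sum_powz_le (lam : R) (K : nat) h : 0 < lam < 1 ->
  (forall u, K%:Z <= `|imbalance h u|) ->
  \sum_u lam ^ `|imbalance h u| <= U%:R * lam ^+ K.
Proof.
move=> /andP[l0 l1] KD.
rewrite mulr_natl -[X in _ *+ X](card_ord U) -sumr_const; apply: ler_sum => u _.
by rewrite exprnP; apply: exprz_anti; [rewrite l0|exact: KD].
Qed.

Lemma half_expr_bounds (q : R) (m n : nat) : 0 < q <= 1 -> 0 < (q ^+ m) ^+ n * (1 / 2) <= 1.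
Proof.
move=> /andP[q0 q1]; have qm1 : (q ^+ m) ^+ n <= 1.
  by rewrite exprn_ile1 ?exprn_ge0 ?exprn_ile1// ltW.
have qm0 : 0 < (q ^+ m) ^+ n by rewrite !exprn_gt0.
by apply/andP; split; lra.
Qed.

(** From any history, [K1] forced steps in which every urn makes an own-spin move along its sign
    bring all imbalances to size [K1], where the potential is at most 1/2. *)
Lemma own_surv (kap : int) : 1 <= kap -> exists2 e, 0 < e <= 1 &
  forall n h, e <= surv step_kernel (okstep kap false) n h.
Proof.
move=> kap1; have [p0 p12] : 0 < p /\ p < 1 / 2 by [].
have [lam [gam [lam_rho lam01 gam01 lam_own lam_total]]] :=
  step_mgf_lt1 U_gt0 rho_gt1 p_gt0 p_lt.
have [/andP[l0 l1] /andP[g0 g1]] := conj lam01 gam01.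
have lz : lam != 0 by rewrite gt_eqF.
have U1 : (1 : R) <= U%:R by rewrite ler1n.
(* Then [C * lam ^ kap] is [U / gam], at least 1, and [C * gam] is [U / lam ^ kap], at least [U]. *)
pose C : R := U%:R / gam / lam ^ kap.
have C0 : 0 <= C by rewrite !divr_ge0 ?exprz_ge0// ltW.
have Ckap : 1 <= C * lam ^ kap.
  by rewrite divfK ?expfz_neq0// ler_pdivlMr// mul1r (le_trans g1).
have Cgam : U%:R <= C * gam.
  rewrite /C mulrAC divfK ?gt_eqF// ler_pdivlMr ?exprz_gt0// ler_piMr//.
  by apply: exprz_le1 => //; apply: le_trans kap1.
have e20 : 0 < 1 / 2 :> R by lra.
have [K1 HK1] := geometric_small (C * U%:R) (e := 1 / 2) (r := lam)
  ltac:(by rewrite ltW) e20.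
pose q : R := (1 - p) / 2.
have q0 : 0 < q by rewrite /q; lra.
have q1 : q <= 1 by rewrite /q; lra.
exists ((q ^+ U) ^+ K1 * (1 / 2)).
  by apply: half_expr_bounds; rewrite q0.
move=> n h.
apply: (surv_forced step_kernel_ge0
  (a := fun h => [ffun u => (false, major h u)])
  (Inv := fun i h => forall u, K1%:Z <= `|imbalance h u| + i%:Z)).
- by rewrite exprn_ge0 ?(ltW q0)//= exprn_ile1// ltW.
- by apply/andP; split; lra.
- move=> {n h}i h inv.
  have imb u : imbalance (rcons h [ffun u => (false, major h u)]) u =
      imbalance h u + sg (major h u) by rewrite imbalance_rcons ffunE.
  have imb' u : sg (major h u) * imbalance (rcons h [ffun u => (false, major h u)]) u =
      `|imbalance h u| + 1 by rewrite imb mulrDr sg_normE sg_sq.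
  split.
  + apply: step_kernel_ge => [|u]; first exact: ltW.
    rewrite ffunE /urn_kernel /= /q ler_wpM2l//; first by lra.
    by rewrite -[leLHS]mul1r cprob_major.
  + rewrite /okstep /= andbT; apply/forallP => u; rewrite imb' !ffunE eqxx /=.
    by rewrite ge_min lexx orbT.
  + move=> u; have := inv u; have := sg_norm_ge (major h u)
      (imbalance (rcons h [ffun u => (false, major h u)]) u).
    by rewrite imb'; clear; lia.
- move=> {}n {}h inv.
  apply: le_trans (surv_potential lam_rho lam01 lam_own lam_total
    C0 Ckap kap1 Cgam n _) => //.
  suff : potential lam C false h <= 1 / 2 by lra.
  apply: le_trans HK1; rewrite /potential mul0r addr0 -mulrA ler_wpM2l//.
  by apply: sum_powz_le => // u; have := inv u; rewrite addr0.
- by move=> u; rewrite lerDr.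
Qed.

(** Forced majority moves along the sign of the total increase it by [U] per step, while each urn
    loses at most 1 per step. Urns with large imbalances thus keep their signs until the total is
    large too. *)
Lemma total_surv : exists K : nat, exists2 e, 0 < e <= 1 &
  forall n h, supercritical h -> (forall u, K%:Z <= `|imbalance h u|) ->
    e <= surv step_kernel (okstep 1 true) n h.
Proof.
have [p0 p12] : 0 < p /\ p < 1 / 2 by [].
have [lam [gam [lam_rho lam01 gam01 lam_own lam_total]]] :=
  step_mgf_lt1 U_gt0 rho_gt1 p_gt0 p_lt.
have [/andP[l0 l1] /andP[g0 g1]] := conj lam01 gam01.
have U1 : (1 : R) <= U%:R by rewrite ler1n.
pose C : R := U%:R / gam / lam.
have C0 : 0 <= C by rewrite !divr_ge0// ltW.
have Ckap : 1 <= C * lam ^ (1 : int).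
  by rewrite expr1z divfK ?gt_eqF// ler_pdivlMr// mul1r (le_trans g1).
have Cgam : U%:R <= C * gam.
  by rewrite /C mulrAC divfK ?gt_eqF// ler_pdivlMr// ler_piMr// ltW.
have e20 : 0 < 1 / 2 :> R by lra.
have [K HK] := geometric_small (C * (U%:R + 1)) (e := 1 / 2) (r := lam)
  ltac:(by rewrite ltW) e20.
pose q : R := p / 2.
have q0 : 0 < q by rewrite /q; lra.
have q1 : q <= 1 by rewrite /q; lra.
(* Half of the initial size is spent on the [K.+1] forced steps. The successor prevents an imbalance
   from reaching 0 meanwhile, even if [K] is 0. *)
exists (K.+1 + K.+1)%N; exists ((q ^+ U) ^+ K.+1 * (1 / 2)).
  by apply: half_expr_bounds; rewrite q0.
move=> n h sup big.
apply: (surv_forced step_kernel_ge0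
  (a := fun h => [ffun=> (true, total_major h)])
  (Inv := fun i h => [/\ supercritical h,
     forall u, K.+1%:Z + i%:Z <= `|imbalance h u| &
     K.+1%:Z <= `|total_imbalance h| + i%:Z])).
- by rewrite exprn_ge0 ?(ltW q0)//= exprn_ile1// ltW.
- by apply/andP; split; lra.
- move=> {n h sup big}i h [sup invu invt].
  set a := [ffun=> _].
  have imb u : sg (major h u) * imbalance (rcons h a) u =
      `|imbalance h u| + sg (major h u) * sg (total_major h).
    by rewrite imbalance_rcons mulrDr sg_normE ffunE.
  have tot : sg (total_major h) * total_imbalance (rcons h a) =
      `|total_imbalance h| + U%:Z.
    rewrite total_imbalance_rcons mulrDr sg_normE; congr (_ + _).
    under eq_bigr do rewrite ffunE /=.
    by rewrite sumr_const card_ord mulrnAr sg_sq natz.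
  have ok : okstep 1 true h a.
    rewrite /okstep /= tot; apply/andP; split; last by move: U_gt0; clear; lia.
    apply/forallP => u; rewrite imb !ffunE eqxx /= andbT ge_min.
    apply/orP; left; have := invu u.
    by have := sg_mul_ge (major h u) (total_major h); clear; lia.
  split => //.
    apply: step_kernel_ge => [|u]; first exact: ltW.
    rewrite ffunE /urn_kernel /= /q ler_wpM2l//; first exact: ltW.
    by rewrite -[leLHS]mul1r cprob_total_major.
  split.
  + rewrite /supercritical (eq_minority (h := h))//; first exact: okstep_major ok.
    exact: okstep_total_major ok.
  + move=> u; have := sg_norm_ge (major h u) (imbalance (rcons h a) u).
    by rewrite imb; have := sg_mul_ge (major h u) (total_major h); have := invu u; clear; lia.
  + have := sg_norm_ge (total_major h) (total_imbalance (rcons h a)).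
    by rewrite tot; move: U_gt0 invt; clear; lia.
- move=> {sup big n h} n h [sup invu invt].
  apply: le_trans (surv_potential lam_rho lam01 lam_own lam_total
    C0 Ckap _ Cgam n _) => //.
  suff : potential lam C true h <= 1 / 2 by lra.
  apply: le_trans HK; rewrite /potential mul1r -mulrA ler_wpM2l// mulrDl mul1r lerD//.
    by apply: sum_powz_le => // u; apply: le_trans (invu u); clear; lia.
  apply: (@le_trans _ _ (lam ^ K.+1%:Z)).
    by apply: exprz_anti => //; move: invt; rewrite addr0.
  by rewrite exprnP; apply: exprz_anti => //; clear; lia.
- by split => //; rewrite lerDr.
Qed.

(* While the total imbalance keeps its sign and the own-spin moves agree with
   the signs of the urns, its drift is nonpositive; it is then exhausted because
   [1 - mu ^ x] is increasing in [x], concave and bounded. *)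
Definition stuck_step kap h a :=
  [&& okstep kap false h a, ~~ supercritical h & ~~ supercritical (rcons h a)].

(** The shift by [U] keeps [1 - mu ^ x] nonnegative after a step that crosses 0. The coefficient of
    [r ^ n] is what the case [n = 0] requires; the constant 2 covers large values of [1 - mu ^ x],
    where no contraction is available. *)
Lemma stuck_surv_le kap (mu : R) (N : nat) : 1 <= kap -> 0 < mu < 1 ->
  1 < step_mgf U p mu N ->
  exists r : R, 0 <= r < 1 /\ forall n h, minority h = N -> ~~ supercritical h ->
    surv step_kernel (stuck_step kap) n h <=
    (2 + (1 - mu ^+ U)^-1 * r ^+ n) * (1 - mu ^ (`|total_imbalance h| + U%:Z)).
Proof.
move=> kap1 /andP[m0 m1] G1; have [p0 p12] : 0 < p /\ p < 1 / 2 by [].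
have mz : mu != 0 by rewrite gt_eqF.
pose G : R := step_mgf U p mu N.
pose r : R := 1 - Num.min ((G - 1) / 2) (1 / 2).
have r0 : 0 <= r by rewrite subr_ge0 ge_min; apply/orP; right; lra.
have r1 : r < 1 by rewrite gtrBl lt_min; apply/andP; split; rewrite /G; lra.
have rG : (G - 1) / 2 >= 1 - r by rewrite opprB addrC subrK ge_min lexx.
have muU : mu ^+ U < 1 by rewrite exprn_ilt1// -?lt0n// ltW.
have c0 : 0 < (1 - mu ^+ U)^-1 by rewrite invr_gt0 subr_gt0.
have powz (z : int) : 0 <= z -> mu ^ (z + U%:Z) <= mu ^+ U.
  by move=> z0; rewrite expfzDr// ler_piMl ?exprn_ge0 ?(ltW m0)// exprz_le1// m0.
exists r; split; first by rewrite r0.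
elim=> [|n IHn] h hN sup.
  rewrite /surv /= expr0 mulr1.
  have := powz `|total_imbalance h| (normr_ge0 _); set y := mu ^ _ => yU.
  apply: (@le_trans _ _ ((1 - mu ^+ U)^-1 * (1 - y))).
    by rewrite ler_pdivlMl ?subr_gt0// mulr1 lerB.
  by rewrite ler_wpM2r ?lerDr//; lra.
have := powz `|total_imbalance h| (normr_ge0 _); set y := mu ^ _ => yU.
have y0 : 0 < y by rewrite exprz_gt0.
(* If [y <= 1 / 2], the bound is at least 1. Otherwise [y * (G - 1)] is large enough for a
   contraction by [r]. *)
have [y2|y2] := leP y (1 / 2).
  apply: le_trans (surv_le1 step_kernel_ge0 step_kernel_sum1 _ _ _) _.
  have : 0 <= (1 - mu ^+ U)^-1 * r ^+ n.+1 by rewrite mulr_ge0 ?exprn_ge0 ?(ltW c0).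
  by set x := _ * _; nra.
pose dom := total_major h.
pose D := `|total_imbalance h|.
pose f a : R := 1 - mu ^ (D + U%:Z + \sum_u sg dom * sg (a u).2).
(* The kernel with own-spin moves made to follow the signs: still a probability, and it dominates
   the original one on ok steps. *)
pose kt u (xc : bool * bool) : R :=
  if xc.1 then p * cprob h u true xc.2 else (1 - p) * (xc.2 == major h u)%:R.
have f0 a : 0 <= f a.
  have : - U%:Z <= \sum_u sg dom * sg (a u).2.
    rewrite -[X in - Posz X](card_ord U).
    have -> : - Posz #|'I_U| = \sum_(u < U) (-1 : int) by rewrite sumr_const mulNrn natz.
    by apply: ler_sum => u _; exact: sg_mul_ge.
  rewrite subr_ge0; set z := \sum_u _ => zU.
  apply: exprz_le1; first by rewrite m0.
  by rewrite -addrA addr_ge0 ?normr_ge0// -lerBlDl sub0r.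
have kt0 u xc : 0 <= kt u xc.
  rewrite /kt; case: ifP => _; rewrite mulr_ge0 ?cprob_ge0//; [exact: ltW|lra].
pose B : R := 2 + (1 - mu ^+ U)^-1 * r ^+ n.
have B0 : 0 <= B by rewrite /B addr_ge0// mulr_ge0 ?exprn_ge0 ?(ltW c0).
apply: (@le_trans _ _ (\sum_(a : step) (\prod_u kt u (a u)) * (B * f a))).
  rewrite survS; apply: ler_sum => a _.
  case: (boolP (stuck_step kap h a)) => ok; last first.
    by rewrite mul0r mulr0 !mulr_ge0// prodr_ge0.
  move: ok => /and3P[ok _ sup']; rewrite mul1r.
  have maj := okstep_major kap1 ok.
  (* After a flip the two minorities would add up to [U], yet both exceed [U / 2]. *)
  have tmaj : total_major (rcons h a) = dom.
    apply: contraNeq sup' => flip; have := minority_flip maj flip => NN.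
    move: sup; rewrite /supercritical -leNgt => sup.
    have : (minority (rcons h a))%:R + (minority h)%:R = U%:R :> R by rewrite -NN natrD.
    have : (1 : R) <= U%:R by rewrite ler1n.
    by move: sup; nra.
  apply: ler_pM; rewrite ?step_kernel_ge0 ?surv_ge0//; first exact: step_kernel_ge0.
    rewrite /step_kernel; apply: ler_prod => u _; rewrite urn_kernel_ge0/=.
    move: ok => /andP[/forallP/(_ u)/and3P[own _ _] _]; move: own.
    rewrite /urn_kernel /kt; case: (a u) => -[] c //= /eqP ->.
    by rewrite eqxx mulr1 ler_piMr ?cprob_le1//; lra.
  apply: le_trans (IHn (rcons h a) _ sup') _; first by rewrite (eq_minority maj tmaj).
  rewrite ler_wpM2l// lerB// le_eqVlt; apply/orP; left; apply/eqP; congr (mu ^ _).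
  rewrite -[in RHS]sg_normE -/(total_major _) tmaj total_imbalance_rcons.
  rewrite mulrDr /dom sg_normE mulr_sumr.
  by rewrite addrAC.
have -> : \sum_(a : step) (\prod_u kt u (a u)) * (B * f a) =
    B * (\prod_u \sum_xc kt u xc -
    y * \prod_u \sum_xc kt u xc * mu ^ (sg dom * sg xc.2)).
  rewrite !bigA_distr_bigA mulr_sumr -sumrB mulr_sumr; apply: eq_bigr => a _.
  rewrite /f expfzDr// (big_morph (exprz mu) (fun x y => expfzDr x y mz) (expr0z mu)).
  by rewrite big_split /= -/y; ring.
have -> : \prod_u \sum_xc kt u xc = 1.
  apply: big1 => u _; rewrite (sum_bool_pair (major h u) (major h u)) /kt /=.
  by rewrite eqxx cprobN; case: (major h u) => /=; ring.
(* Since [mu < 1], the mean is least when all majority moves follow the sign of the total, which is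
   the case computed by [step_mgf]. *)
have GP : G <= \prod_u \sum_xc kt u xc * mu ^ (sg dom * sg xc.2).
  rewrite /G -hN -(prod_step_mgf h mz); apply: ler_prod => u _; apply/andP; split.
    by rewrite addr_ge0 ?mulr_ge0 ?exprz_ge0 ?(ltW m0) ?(ltW p0)//; lra.
  rewrite (sum_bool_pair (major h u) dom) /kt /= eqxx.
  rewrite (_ : (~~ major h u == major h u) = false); last by case: (major h u).
  rewrite mulr1 mulr0 mul0r addr0 lerD2l sgN mulrN sg_sq cprobN expr1z exprN1.
  have := cprob_ge0 h u true dom; have := cprob_le1 h u true dom.
  set c := cprob _ _ _ _ => c1 cge.
  have mV : mu <= mu^-1 by apply: le_trans (ltW m1) _; rewrite invf_ge1// ltW.
  have : p * (1 - c) * mu <= p * (1 - c) * mu^-1.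
    by rewrite ler_wpM2l// mulr_ge0 ?(ltW p0) ?subr_ge0.
  lra.
have yG : y * G <= y * \prod_u \sum_xc kt u xc * mu ^ (sg dom * sg xc.2).
  by rewrite ler_pM2l.
have y1 : y < 1 by apply: le_lt_trans muU.
have key : 1 - y * G <= r * (1 - y).
  have : 1 - r > 0 by rewrite subr_gt0.
  by move: rG; rewrite -/G in G1; nra.
apply: (@le_trans _ _ (B * (1 - y * G))); first by rewrite ler_wpM2l// lerB.
apply: (@le_trans _ _ (B * (r * (1 - y)))); first by rewrite ler_wpM2l.
rewrite mulrA ler_wpM2r ?subr_ge0 ?(ltW y1)// /B mulrDl exprSr -[X in _ + X]mulrA.
by rewrite mulrA lerD2r; lra.
Qed.

Lemma stuck_dies kap h (e : R) : 1 <= kap -> 0 < e ->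
  exists n, surv step_kernel (stuck_step kap) n h <= e.
Proof.
move=> kap1 e0; have [sup|sup] := boolP (supercritical h).
  exists 1%N; rewrite survS big1 ?(ltW e0)// => a _.
  by rewrite /stuck_step sup andbF mul0r mulr0.
pose k := (`|total_imbalance h| + U%:Z)%R.
have k0 : 0 < (`|k|%N)%:R :> R by rewrite ltr0n; move: U_gt0; rewrite /k; clear; lia.
(* Chosen so that [1 - mu ^ k <= k * t = e / 4]; the constant term then contributes at most [e / 2].
   The rate [r] depends on [mu], so [n] is chosen last. *)
pose t : R := e / (4 * (`|k|%N)%:R).
have t0 : 0 < t by rewrite divr_gt0 ?mulr_gt0.
pose mu : R := expR (- t).
have mu0 : 0 < mu by exact: expR_gt0.
have mu1 : mu < 1 by rewrite expR_lt1 oppr_lt0.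
have G1 : 1 < step_mgf U p mu (minority h).
  apply: step_mgf_gt1; rewrite ?minority_le//.
  by move: sup; rewrite /supercritical -leNgt.
have [r [r01 bound]] := stuck_surv_le kap1 (mu := mu) ltac:(by rewrite mu0) G1.
have [n hn] := geometric_small (1 - mu ^+ U)^-1 r01 (e := e / 2) ltac:(by rewrite divr_gt0).
exists n; apply: le_trans (bound n h erefl sup) _; rewrite -/k.
have -> : k = `|k|%N :> int by rewrite gez0_abs// /k addr_ge0.
rewrite -exprnP.
have muk : 1 - mu ^+ `|k|%N <= e / 4.
  rewrite -expRM_natl lerBlDr -lerBlDl; apply: le_trans (expR_ge1Dx _).
  rewrite lerD2l mulrN lerN2 (_ : _ * t = e / 4)// /t.
  by field; rewrite gt_eqF.
have mukle : 1 - mu ^+ `|k|%N <= 1 by rewrite gerBl exprn_ge0// ltW.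
have muk0 : 0 <= 1 - mu ^+ `|k|%N by rewrite subr_ge0 exprn_ile1// ltW.
rewrite mulrDl.
apply: (@le_trans _ _ (2 * (e / 4) + e / 2 * 1)); last lra.
rewrite lerD// ?ler_wpM2l//; apply: (@le_trans _ _ (e / 2 * (1 - mu ^+ `|k|%N))).
  by rewrite ler_wpM2r.
by rewrite ler_wpM2l// ltW// divr_gt0.
Qed.

Lemma spin_dies u (b : bool) h (e : R) : 0 < e ->
  exists n, surv step_kernel (fun _ a => (a u).1 == b) n h <= e.
Proof.
move=> e0; have [p0 p12] : 0 < p /\ p < 1 / 2 by [].
pose q : R := if b then p else 1 - p.
have E n g : surv step_kernel (fun _ a => (a u).1 == b) n g = q ^+ n.
  elim: n g => [//|n IHn] g; rewrite survS.
  under eq_bigr do rewrite IHn mulrA.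
  rewrite -mulr_suml (step_kernel_marginal g u (fun xc => (xc.1 == b)%:R)) exprS.
  congr (_ * _); rewrite (sum_bool_pair true true) /urn_kernel /q /cprob.
  by case: (b) => /=; ring.
have q01 : 0 <= q < 1 by rewrite /q; case: (b); apply/andP; split; lra.
by have [n] := geometric_small 1 q01 e0; rewrite mul1r => H; exists n; rewrite E.
Qed.

End UrnKernel.

(** * Almost sure fixation *)

Section AlmostSureFixation.
Context (R : realType) (U : nat) (rho p : R).
Hypotheses (U_gt0 : (0 < U)%N) (rho_gt1 : 1 < rho) (p_gt0 : 0 < p) (p_lt : p < 1 / 2).
Context d (T : measurableType d) (Q : probability T R) (xi : nat -> T -> step U).
Hypothesis mxi : forall i a, measurable [set w | xi i w = a].
Hypothesis cyl_rcons : forall h a,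
  Q (cyl xi (rcons h a)) = (Q (cyl xi h) * (step_kernel rho p h a)%:E)%E.

Definition fixation (s : 'I_U -> bool) (dom : bool) (m : nat) (w : T) : Prop :=
  forall n u, (m <= n)%N -> (xi n w u).2 = if (xi n w u).1 then dom else s u.

Definition spins_io (w : T) : Prop :=
  forall u b m, exists2 n, (m <= n)%N & (xi n w u).1 = b.

Lemma ae_spins_io : {ae Q, forall w, spins_io w}.
Proof.
have H : {ae Q, forall w, forall ub : 'I_U * bool,
    ~ exists m, forall n, (m <= n)%N -> (xi n w ub.1).1 == ub.2}.
  apply: filter_forall => -[u b].
  have := not_eventually_ok (step_kernel_ge0 rho_gt1 p_gt0 p_lt) mxi cyl_rcons
    (ok := fun _ a => (a u).1 == b).
  by apply => h e e0; exact: spin_dies.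
apply: filterS H => w H u b m; apply: contrapT => nb.
apply: (H (u, ~~ b)); exists m => n mn /=.
have : (xi n w u).1 <> b by move=> E; apply: nb; exists n.
by case: (xi n w u).1 b {H nb} => -[].
Qed.

Lemma ae_fixation : {ae Q, forall w, exists s dom m, fixation s dom m w /\
  (1 - p) * #|[pred u | s u != dom]|%:R < U%:R / 2}.
Proof.
have K0 (h : seq (step U)) a : 0 <= step_kernel rho p h a.
  exact: step_kernel_ge0.
have K1 := @step_kernel_sum1 R U rho p.
have [K [e2 e2_01 surv2]] := total_surv U_gt0 rho_gt1 p_gt0 p_lt.
(* At least [K], as [good] demands, and at least 1 even if [K] is 0. *)
pose kap : int := K.+1%:Z.
have kap1 : 1 <= kap by [].
have [e1 e1_01 surv1] := own_surv U_gt0 rho_gt1 p_gt0 p_lt kap1.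
have A1 := good_io_eventually_ok K0 K1 mxi cyl_rcons (good := xpredT) e1_01
  (fun n h _ => surv1 n h).
have A2 := not_eventually_ok K0 mxi cyl_rcons
  (fun h e e0 => stuck_dies U_gt0 rho_gt1 p_gt0 p_lt h kap1 e0).
pose good (h : seq (step U)) := supercritical p h && [forall u, K%:Z <= `|imbalance h u|].
have A3 : {ae Q, forall w, (forall m, exists2 n, (m <= n)%N & good (hist xi n w)) ->
    exists m, forall n, (m <= n)%N -> okstep 1 true (hist xi n w) (xi n w)}.
  apply: (good_io_eventually_ok K0 K1 mxi cyl_rcons e2_01) => n h /andP[sup /forallP].
  exact: surv2.
apply: filterS3 A1 A2 A3 => w H1 H2 H3.
have [m1 ok1] : exists m, forall n, (m <= n)%N -> okstep kap false (hist xi n w) (xi n w).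
  by apply: H1 => m; exists m.
have grow k u : Num.min kap k%:Z <= `|imbalance (hist xi (m1 + k) w) u|.
  elim: k => [|k IHk]; first by rewrite ge_min normr_ge0 orbT.
  rewrite addnS histS.
  have /andP[/forallP/(_ u)/and3P[_ H _] _] := ok1 (m1 + k)%N (leq_addr _ _).
  have := sg_norm_ge (major (hist xi (m1 + k) w) u)
    (imbalance (rcons (hist xi (m1 + k) w) (xi (m1 + k)%N w)) u).
  move: H IHk => H IHk /(le_trans H).
  by apply: le_trans; move: IHk; rewrite !le_min !ge_min lexx /=; clear; lia.
(* Otherwise all late steps would be [stuck_step], against [H2]. *)
have sup_io m : exists2 n, (m <= n)%N & supercritical p (hist xi n w).
  apply: contrapT => nsup; apply: H2; exists (maxn m m1) => n.
  rewrite geq_max => /andP[mn m1n]; apply/and3P; split; first exact: ok1.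
    by apply/negP => sup; apply: nsup; exists n.
  by rewrite -histS; apply/negP => sup; apply: nsup; exists n.+1 => //; exact: leqW.
have [m2 ok2] : exists m, forall n, (m <= n)%N -> okstep 1 true (hist xi n w) (xi n w).
  apply: H3 => m; have [n] := sup_io (maxn m (m1 + K.+1)).
  rewrite geq_max => /andP[mn m1n] sup; exists n => //.
  rewrite /good sup; apply/forallP => u.
  have := grow (n - m1)%N u; rewrite subnKC ?(leq_trans _ m1n) ?leq_addr//.
  by move: m1n; rewrite /kap; clear; lia.
(* All signs are constant from [m3] on, and supercriticality there is the required inequality. *)
have [m3 m23 sup] := sup_io m2.
pose s u := major (hist xi m3 w) u; pose dom := total_major (hist xi m3 w).
have const k : (forall u, major (hist xi (m3 + k) w) u = s u) /\
    total_major (hist xi (m3 + k) w) = dom.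
  elim: k => [|k [IHs IHd]]; first by rewrite addn0.
  have ok : okstep 1 true (hist xi (m3 + k) w) (xi (m3 + k) w).
    by apply: ok2; exact: leq_trans (leq_addr _ _).
  rewrite addnS histS; split; last by rewrite (okstep_total_major ok).
  by move=> u; rewrite (okstep_major _ ok).
exists s, dom, m3; split; last exact: sup.
move=> n u m3n; have [cs cd] := const (n - m3)%N; rewrite subnKC// in cs cd.
have /andP[/forallP/(_ u)/and3P[own _ tot] _] := ok2 n (leq_trans m23 m3n).
move: own tot; rewrite cs cd; case: (xi n w u) => -[] c /=.
  by move=> _ /eqP.
by move=> /eqP.
Qed.

End AlmostSureFixation.

(** * The averaged law of the mechanism *)

Lemma uniform_prob_lt (R : realType) (q : R) : 0 <= q <= 1 ->
  uniform_prob (@ltr01 R) [set r | r < q] = q%:E.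
Proof.
move=> /andP[q0 q1]; rewrite /uniform_prob integral_uniform_pdf.
have -> : [set r | r < q] `&` `[0, 1]%classic = `[0, q[%classic.
  apply/seteqP; split => r /=; rewrite !in_itv /=.
    by move=> [-> /andP[-> _]].
  by move=> /andP[r0 rq]; split => //; rewrite r0 (le_trans (ltW rq)).
rewrite (eq_integral (fun=> 1%:E)); last first.
  move=> r; rewrite inE /= in_itv /= => /andP[r0 rq].
  by rewrite /uniform_pdf r0 (le_trans (ltW rq))//= subr0 invr1.
rewrite integral_cst//= mul1e lebesgue_measure_itv /= lte_fin.
by case: ltP => [_|]; rewrite ?oppr0 ?adde0// => q0'; congr EFin; apply/le_anti; rewrite q0 q0'.
Qed.

Lemma measurable_ltr_set (R : realType) (q : R) : measurable [set r : R | r < q].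
Proof.
have -> : [set r : R | r < q] = `]-oo, q[%classic.
  by apply/seteqP; split => r /=; rewrite in_itv.
exact: measurable_itv.
Qed.

Section AnnealedLaw.
Context (R : realType) (U : nat) (rho p : R).
Hypotheses (rho_gt1 : 1 < rho) (p_gt0 : 0 < p) (p_lt : p < 1 / 2).
Context (mu : probability (environment U) R).
Hypothesis hmu : iid mu (bernoulli_prob p) (@env_coord U).
Context (d : measure_display) (Omega : measurableType d) (P : probability Omega R).
Context (V : nat * 'I_U -> Omega -> R).
Hypothesis hV : iid P (uniform_prob (@ltr01 R)) V.

Definition mechanism (t : environment U * Omega) : nat -> 'I_U -> nat :=
  urn_mechanism rho t.1 (fun i => V i t.2).

Definition mechanism_step (n : nat) (t : environment U * Omega) : step U :=
  [ffun u => (t.1 n u, color (mechanism t) n u)].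

Lemma mechanismS t n u :
  mechanism t n.+1 u = (mechanism t n u + color (mechanism t) n u)%N.
Proof.
rewrite /mechanism /color /=; case: ifP => _; rewrite ?eqxx ?addn1//.
by rewrite -[X in X == _]addn0 -addn1 eqn_add2l addn0.
Qed.

Lemma mechanismE t n u : mechanism t n u = nblack (hist mechanism_step n t) u.
Proof.
elim: n => [//|n IHn].
by rewrite mechanismS histS /nblack -cats1 count_cat /= addn0 ffunE /= IHn.
Qed.

Lemma color_mechanism t n u : color (mechanism t) n u =
  (V (n, u) t.2 < bprob rho (hist mechanism_step n t) u (t.1 n u)).
Proof.
have E v : urn_mechanism rho t.1 (fun i => V i t.2) n v =
    nblack (hist mechanism_step n t) v by exact: mechanismE.
rewrite /color /mechanism /= /bprob size_hist.
have -> : (\sum_(j < U) urn_mechanism rho t.1 (fun i => V i t.2) n j)%N =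
   (\sum_(v < U) nblack (hist mechanism_step n t) v)%N by apply: eq_bigr => j _.
have -> : (\sum_(j < U) (n - urn_mechanism rho t.1 (fun i => V i t.2) n j))%N =
   (\sum_(v < U) (n - nblack (hist mechanism_step n t) v))%N.
  by apply: eq_bigr => j _; rewrite E.
rewrite !E; case: ifP => H; first by rewrite eqxx.
by rewrite -[X in X == _]addn0 -addn1 eqn_add2l.
Qed.

(** Lists without repetition the indices used before time [n], in the form [mutually_independent]
    expects. *)
Fixpoint time_urns (n : nat) : seq (nat * 'I_U) :=
  if n is m.+1 then time_urns m ++ [seq (m, u) | u <- enum 'I_U] else [::].

Lemma mem_time_urns n i : (i \in time_urns n) = (i.1 < n)%N.
Proof.
elim: n => //= n IHn; rewrite mem_cat IHn ltnS [RHS]leq_eqVlt orbC; congr (_ || _).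
apply/mapP/eqP => [[u _ ->]//|<-]; exists i.2; first by rewrite mem_enum.
by case: i {IHn}.
Qed.

Lemma time_urns_uniq n : uniq (time_urns n).
Proof.
elim: n => //= n IHn; rewrite cat_uniq IHn map_inj_uniq ?enum_uniq ?andbT/=; last first.
  by move=> u v [].
by apply/hasPn => _ /mapP[u _ ->]; rewrite mem_time_urns ltnn.
Qed.

Let a0 : step U := [ffun=> (false, false)].

Let spin_set (h : seq (step U)) (i : nat * 'I_U) : set bool := [set (nth a0 h i.1 i.2).1].

Let unif_set (h : seq (step U)) (i : nat * 'I_U) : set R :=
  let a := nth a0 h i.1 i.2 in
  [set r | (r < bprob rho (take i.1 h) i.2 a.1) = a.2].

Let measurable_unif_set h i : measurable (unif_set h i).
Proof.
rewrite /unif_set; case: (nth a0 h i.1 i.2) => x c /=; set q := bprob _ _ _ _.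
have H := measurable_ltr_set q.
case: c; first by rewrite (_ : mkset _ = [set r | r < q])//; apply/seteqP; split.
rewrite (_ : mkset _ = ~` [set r | r < q]); first exact: measurableC.
by apply/seteqP; split => r /= => [->|/negP/negbTE].
Qed.

Let env_rect h := \bigcap_(i in [set` time_urns (size h)]) (@env_coord U i @^-1` spin_set h i).
Let unif_rect h := \bigcap_(i in [set` time_urns (size h)]) (V i @^-1` unif_set h i).

(** Once [h] is fixed, the thresholds for the uniform variables are deterministic, so each spin and
    each variable is constrained separately. Conversely, the constraints rebuild the history step by
    step. *)
Lemma cyl_rect h : cyl mechanism_step h = env_rect h `*` unif_rect h.
Proof.
apply/seteqP; split => -[x w].
  rewrite /cyl /= => H; have Hi i u : (i < size h)%N ->
      nth a0 h i u = (x i u, color (mechanism (x, w)) i u).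
    by move=> ih; rewrite -H nth_mkseq// ffunE.
  split => -[i u] /=; rewrite mem_time_urns /= => ih.
    by rewrite /spin_set /= Hi.
  rewrite /unif_set /= Hi//= color_mechanism /=; congr (_ < bprob _ _ _ _).
  by rewrite -[in LHS]H /hist /mkseq -map_take take_iota (minn_idPl (ltnW ih)).
move=> [/= Hx Hw]; rewrite /cyl /=.
suff : forall n, (n <= size h)%N -> hist mechanism_step n (x, w) = take n h.
  by move=> /(_ _ (leqnn _)); rewrite take_size.
elim=> [|n IHn] nh; first by rewrite take0.
rewrite histS IHn ?(ltnW nh)// (take_nth a0 nh); congr rcons.
apply/ffunP => u; rewrite ffunE /=.
have inU : [set` time_urns (size h)] (n, u) by rewrite /= mem_time_urns.
have := Hx _ inU; have := Hw _ inU; rewrite /unif_set /spin_set /= => vE xE.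
have xE' : x n u = (nth a0 h n u).1 by [].
rewrite color_mechanism /= IHn ?(ltnW nh)// xE' vE.
by case: (nth a0 h n u).
Qed.

Lemma measurable_rects h : measurable (env_rect h) /\ measurable (unif_rect h).
Proof.
have [mx _ _] := hmu; have [mv _ _] := hV.
split; apply: fin_bigcap_measurable => // i _.
  by rewrite -[X in measurable X]setTI; exact: mx.
by rewrite -[X in measurable X]setTI; apply: mv => //; exact: measurable_unif_set.
Qed.

Lemma measurable_cyl h : measurable (cyl mechanism_step h).
Proof. by have [? ?] := measurable_rects h; rewrite cyl_rect; exact: measurableX. Qed.

Lemma prob_cyl h : (mu \x P)%E (cyl mechanism_step h) =
  (\prod_(i <- time_urns (size h)) (bernoulli_prob p (spin_set h i) *
     uniform_prob (@ltr01 R) (unif_set h i)))%E.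
Proof.
have [? ?] := measurable_rects h.
have [_ lawx indx] := hmu; have [_ lawv indv] := hV.
rewrite cyl_rect product_measure1E// big_split /=; congr (_ * _)%E.
  rewrite /env_rect indx ?time_urns_uniq//; apply: eq_bigr => i _; exact: lawx.
rewrite /unif_rect indv ?time_urns_uniq//; last by move=> i _; exact: measurable_unif_set.
by apply: eq_bigr => i _; exact: lawv (measurable_unif_set h i).
Qed.

Lemma prob_cyl_rcons h a : (mu \x P)%E (cyl mechanism_step (rcons h a)) =
  ((mu \x P)%E (cyl mechanism_step h) * (step_kernel rho p h a)%:E)%E.
Proof.
have [p0 p12] : 0 < p /\ p < 1 / 2 by [].
rewrite !prob_cyl size_rcons /= big_cat /=; congr (_ * _)%E.
  (* Earlier constraints involve only earlier steps, so appending [a] leaves them unchanged. *)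
  apply: eq_big_seq => i; rewrite mem_time_urns => ih.
  have En : nth a0 (rcons h a) i.1 = nth a0 h i.1 by rewrite nth_rcons ih.
  by rewrite /spin_set /unif_set En -cats1 takel_cat// ltnW.
rewrite big_map big_enum /= /step_kernel (big_morph EFin EFinM (erefl _)).
apply: eq_bigr => u _; rewrite /urn_kernel EFinM.
rewrite /spin_set /unif_set /= nth_rcons ltnn eqxx -cats1 take_size_cat//.
case: (a u) => x c /=; congr (_ * _)%E.
  rewrite bernoulli_probE; last by apply/andP; split; lra.
  have in1 (b c' : bool) : (b \in [set c']) = (b == c') by apply/idP/eqP; rewrite inE.
  by rewrite !diracE !in1; case: x; rewrite /= ?eqxx ?mule1 ?mule0 ?adde0 ?add0e.
have q01 : 0 <= bprob rho h u x <= 1.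
  by rewrite (cprob_ge0 rho_gt1 h u x true) (cprob_le1 rho_gt1 h u x true).
case: c => /=.
  by rewrite -(uniform_prob_lt q01); congr (uniform_prob _ _); apply/seteqP; split.
rewrite (_ : mkset _ = ~` [set r | r < bprob rho h u x]); last first.
  by apply/seteqP; split => r /= => [->|/negP/negbTE].
rewrite probability_setC; last exact: measurable_ltr_set.
by rewrite /= uniform_prob_lt.
Qed.

Lemma measurable_mechanism_step n a : measurable [set t | mechanism_step n t = a].
Proof.
rewrite (_ : mkset _ = \bigcup_(h : seq (step U)) if size h == n then
    cyl mechanism_step (rcons h a) else set0).
  apply: countable_bigcupT_measurable; first exact: countableP.
  by move=> h; case: ifP => // _; exact: measurable_cyl.
apply/seteqP; split => t /=.
  move=> <-; exists (hist mechanism_step n t) => //.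
  by rewrite size_hist eqxx /cyl /= size_rcons size_hist histS.
by case=> h _; case: eqP => // <-; rewrite /cyl /= size_rcons histS => /rcons_inj[].
Qed.

End AnnealedLaw.

(** * Suitability *)

Section MeasurablePredicates.
Context d (T : measurableType d).
Implicit Types A B : T -> Prop.

Lemma measurable_exists (I : countType) (A : I -> T -> Prop) :
  (forall i, measurable [set t | A i t]) -> measurable [set t | exists i, A i t].
Proof.
move=> mA; rewrite (_ : mkset _ = \bigcup_i [set t | A i t]).
  by apply: countable_bigcupT_measurable => //; exact: countableP.
by apply/seteqP; split => t /= [i]; exists i.
Qed.

Lemma measurable_not A : measurable [set t | A t] -> measurable [set t | ~ A t].
Proof. exact: measurableC. Qed.

Lemma measurable_forall (I : countType) (A : I -> T -> Prop) :
  (forall i, measurable [set t | A i t]) -> measurable [set t | forall i, A i t].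
Proof.
move=> mA; rewrite (_ : mkset _ = [set t | ~ exists i, ~ A i t]).
  by apply/measurable_not/measurable_exists => i; exact: measurable_not.
apply/seteqP; split => t /= H; first by case=> i.
by move=> i; apply: contrapT => nA; apply: H; exists i.
Qed.

Lemma measurable_imply (b : Prop) A :
  measurable [set t | A t] -> measurable [set t | b -> A t].
Proof.
move=> mA; have [Hb|nb] := pselect b.
  by rewrite (_ : mkset _ = [set t | A t])//; apply/seteqP; split => t /=; [apply|].
by rewrite (_ : mkset _ = setT)//; apply/seteqP; split => t //= _ /nb.
Qed.

End MeasurablePredicates.

(** By Fubini, almost every section of a null set containing the complement of [A] is null. *)
Lemma ae_xsection (R : realType) (d1 d2 : measure_display) (T1 : measurableType d1)
    (T2 : measurableType d2) (P1 : probability T1 R) (P2 : probability T2 R)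
    (A : set (T1 * T2)) : measurable A ->
  {ae (P1 \x P2)%E, forall t, A t} -> {ae P1, forall x, P2 (xsection A x) = 1%E}.
Proof.
move=> mA [N [mN N0 AN]].
have mphi := measurable_fun_xsection P2 mN.
have : (\int[P1]_x `|(P2 \o xsection N) x| = 0)%E.
  under eq_integral do rewrite gee0_abs//.
  exact: N0.
move=> /(ae_eq_integral_abs P1 measurableT mphi); apply: filterS => x /(_ I) /= Nx.
have mAx := measurable_xsection x mA.
have mNx := measurable_xsection x mN.
have C0 : P2 (~` xsection A x) = 0%E.
  apply: (subset_measure0 _ mNx _ Nx); first exact: measurableC.
  move=> w nA; rewrite /xsection /= inE; apply: AN => /= Axw; apply: nA.
  by rewrite /xsection /= inE.
have := probability_setC P2 (measurableC mAx).
by rewrite setCK C0 sube0.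
Qed.

Section SuitableMechanism.
Context (R : realType) (U : nat) (rho p : R).
Hypotheses (U_gt0 : (0 < U)%N) (rho_gt1 : 1 < rho) (p_gt0 : 0 < p) (p_lt : p < 1 / 2).
Context (mu : probability (environment U) R).
Hypothesis hmu : iid mu (bernoulli_prob p) (@env_coord U).
Context (d : measure_display) (Omega : measurableType d) (P : probability Omega R).
Context (V : nat * 'I_U -> Omega -> R).
Hypothesis hV : iid P (uniform_prob (@ltr01 R)) V.

Let xi := mechanism_step rho V.

Definition suitable_event : set (environment U * Omega) :=
  [set t | suitable t.1 (mechanism rho V t) /\
     (1 - p) * (num_nonconformist t.1 (mechanism rho V t))%:R < U%:R / 2].

Lemma mechanism_urn_path t : is_urn_path (mechanism rho V t).
Proof.
split => [//|n u]; rewrite mechanismS; case: (color _ _ _); rewrite ?addn1 ?addn0.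
  by right.
by left.
Qed.

(** Urns with [s u = dom] are conformist and the others nonconformist. Recurrence of both spins
    keeps the former from also counting as nonconformist, for whatever color [dd]. *)
Lemma fixation_suitable t s dom m : fixation xi s dom m t -> spins_io xi t ->
  (1 - p) * #|[pred u | s u != dom]|%:R < U%:R / 2 -> suitable_event t.
Proof.
move=> fix_t io ns.
have p'0 : 0 <= 1 - p by have : p < 1 / 2 by []; lra.
have colE n u : (m <= n)%N ->
    color (mechanism rho V t) n u = if t.1 n u then dom else s u.
  by move=> mn; have := fix_t n u mn; rewrite /xi ffunE.
have io' u b k : exists2 n, (k <= n)%N & t.1 n u = b.
  by have [n kn] := io u b k; rewrite /xi ffunE /= => H; exists n.
split.
  split; first exact: mechanism_urn_path.
  exists dom, m => u; case: (eqVneq (s u) dom) => [su|su].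
    by left => n mn; rewrite colE// su if_same.
  right => n mn; rewrite colE//; split => -> //.
  exact/eqP.
apply: le_lt_trans ns; rewrite ler_wpM2l// ler_nat; apply: subset_leq_card.
apply/fintype.subsetP => u; rewrite !inE => -[dd [n0 [_ nc]]].
apply/negP => /eqP su.
have [n1] := io' u true (maxn m n0); rewrite geq_max => /andP[mn1 n01] x1.
have [n2] := io' u false (maxn m n0); rewrite geq_max => /andP[mn2 n02] x2.
have /(_ x1) := (nc n1 n01).1; have /(_ x2) := (nc n2 n02).2.
by rewrite !colE// x1 x2 su.
Qed.

Let mxi n a : measurable [set t | xi n t = a].
Proof. exact: (measurable_mechanism_step rho hmu hV). Qed.

Let measurable_step (psi : step U -> Prop) n : measurable [set t | psi (xi n t)].
Proof. exact: (measurable_hist_pred mxi n [set q | psi q.2]). Qed.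

Let measurable_conformist dd n0 u :
  measurable [set t | conformist_from (mechanism rho V t) dd n0 u].
Proof.
apply: measurable_forall => n; apply: measurable_imply.
have := measurable_step (fun a => (a u).2 = dd) n.
by congr measurable; apply/seteqP; split => t /=; rewrite /xi ffunE.
Qed.

Let measurable_nonconformist_from dd n0 u :
  measurable [set t | nonconformist_from t.1 (mechanism rho V t) dd n0 u].
Proof.
apply: measurable_forall => n; apply: measurable_imply.
have := measurable_step (fun a => ((a u).1 = true -> (a u).2 = dd) /\
  ((a u).1 = false -> (a u).2 <> dd)) n.
by congr measurable; apply/seteqP; split => t /=; rewrite /xi ffunE.
Qed.

Let measurable_suitable_from dd n0 :
  measurable [set t | suitable_from t.1 (mechanism rho V t) dd n0].
Proof.
apply: measurable_forall => u.
exact: (measurableU _ _ (measurable_conformist _ _ _) (measurable_nonconformist_from _ _ _)).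
Qed.

Let measurable_nonconformist u :
  measurable [set t | nonconformist t.1 (mechanism rho V t) u].
Proof.
apply: measurable_exists => dd; apply: measurable_exists => n0.
exact: (measurableI _ _ (measurable_suitable_from _ _) (measurable_nonconformist_from _ _ _)).
Qed.

Lemma measurable_suitable_event : measurable suitable_event.
Proof.
apply: (measurableI [set t | suitable t.1 (mechanism rho V t)] [set t |
    (1 - p) * (num_nonconformist t.1 (mechanism rho V t))%:R < U%:R / 2]).
  rewrite (_ : mkset _ = [set t | exists dd n0, suitable_from t.1 (mechanism rho V t) dd n0]).
    by apply: measurable_exists => dd; apply: measurable_exists => n0.
  apply/seteqP; split => t /=; first by case.
  by split => //; exact: mechanism_urn_path.
(* The condition on the count becomes a finite union over the possible sets of nonconformist
   urns. *)
rewrite (_ : mkset _ = [set t | exists D : {set 'I_U}, (1 - p) * #|D|%:R < U%:R / 2 /\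
    forall u, (u \in D) = `[< nonconformist t.1 (mechanism rho V t) u >]]).
  apply: measurable_exists => D.
  apply: (measurableI [set t | (1 - p) * #|D|%:R < U%:R / 2] [set t | forall u,
      (u \in D) = `[< nonconformist t.1 (mechanism rho V t) u >]]).
    case: (boolP ((1 - p) * #|D|%:R < U%:R / 2)) => H.
      by rewrite (_ : mkset _ = setT)//; apply/seteqP; split.
    by rewrite (_ : mkset _ = set0)//; apply/seteqP; split.
  apply: measurable_forall => u; case: (u \in D).
    rewrite (_ : mkset _ = [set t | nonconformist t.1 (mechanism rho V t) u])//.
    by apply/seteqP; split => t /=; case: asboolP.
  rewrite (_ : mkset _ = [set t | ~ nonconformist t.1 (mechanism rho V t) u]).
    exact: measurable_not.
  by apply/seteqP; split => t /=; case: asboolP.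
apply/seteqP; split => t /=.
  move=> H; exists [set u | `[< nonconformist t.1 (mechanism rho V t) u >]]%SET; split.
    by move: H; rewrite /num_nonconformist cardsE.
  by move=> u; rewrite inE.
case=> D [H HD]; rewrite (_ : num_nonconformist _ _ = #|D|)//.
by apply: eq_card => u; rewrite inE HD.
Qed.

Lemma ae_suitable_event : {ae (mu \x P)%E, forall t, suitable_event t}.
Proof.
have cylE := prob_cyl_rcons rho_gt1 p_gt0 p_lt hmu hV.
have A1 := ae_fixation U_gt0 rho_gt1 p_gt0 p_lt mxi cylE.
have A2 := ae_spins_io rho_gt1 p_gt0 p_lt mxi cylE.
apply: filterS2 A1 A2 => t [s [dom [m [fix_t ns]]]] io.
exact: fixation_suitable fix_t io ns.
Qed.

End SuitableMechanism.

Theorem theorem3p10 (R : realType) (U : nat) (rho p : R)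
    (hU : (1 <= U)%N) (hrho : 1 < rho) (hp0 : 0 < p) (hp : p < 1 / 2)
    (mu : probability (environment U) R)
    (hmu : iid mu (bernoulli_prob p) (@env_coord U))
    (d : measure_display) (Omega : measurableType d) (P : probability Omega R)
    (V : nat * 'I_U -> Omega -> R)
    (hV : iid P (uniform_prob (@ltr01 R)) V) :
  {ae mu, forall x : environment U,
     P [set w | let r := urn_mechanism rho x (fun i => V i w) in
                suitable x r /\
                (1 - p) * (num_nonconformist x r)%:R < U%:R / 2] = 1%E}.
Proof.
apply: filterS (ae_xsection (measurable_suitable_event rho hmu hV)
  (ae_suitable_event hU hrho hp0 hp hmu hV)) => x <-.
by congr (P _); apply/seteqP; split => w /=; rewrite /xsection /= inE.
Qed.
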